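(* Let $\Lambda\subset\mathbb{R}^n$ be a full-rank lattice with $\operatorname{vol}(\Lambda)=1$, and let $\Lambda^\star$ be its dual. Then $\Xi_\Lambda(\tau)=\Xi_\Lambda(1/\tau)$ for all $\tau>0$ (i.e., $\tau_0=1$ is a symmetry point of the secrecy function, so that $\Lambda$ achieves its weak secrecy gain at $\tau=1$) if and only if $\Lambda$ is formally unimodular, i.e., $\Theta_\Lambda=\Theta_{\Lambda^\star}$.
   Context: For a full-rank lattice $\Lambda=\{\mathbf{u}\mathsf{G}:\mathbf{u}\in\mathbb{Z}^n\}$, $\operatorname{vol}(\Lambda)=|\det\mathsf{G}|$ and the dual lattice $\Lambda^\star$ is generated by $(\mathsf{G}^{-1})^T$. The theta series is $\Theta_\Lambda(z)=\sum_{\boldsymbol{\lambda}\in\Lambda} e^{i\pi z\|\boldsymbol{\lambda}\|^2}$ for $\operatorname{Im} z>0$. If $\operatorname{vol}(\Lambda)=\nu^n$, the secrecy function is $\Xi_\Lambda(\tau)=\Theta_{\nu\mathbb{Z}^n}(i\tau)/\Theta_\Lambda(i\tau)$, $\tau>0$. A point $\tau_0$ is a symmetry point if $\Xi_\Lambda(\tau_0\tau)=\Xi_\Lambda(\tau_0/\tau)$ for all $\tau>0$; the weak secrecy gain is then $\Xi_\Lambda(\tau_0)$. $\Lambda$ is formally unimodular if $\Theta_\Lambda=\Theta_{\Lambda^\star}$. *)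

(* Defs.v *)
From HB Require Import structures.
From mathcomp Require Import all_boot all_order all_algebra.
From mathcomp Require Import all_classical all_reals all_analysis.
Set Implicit Arguments. Unset Strict Implicit. Unset Printing Implicit Defensive.
Import Order.TTheory GRing.Theory Num.Theory.
Local Open Scope ring_scope.

Section Lattices.
Variable R : realType.

(* A lattice Lambda = { u G : u in Z^n } is given by its generator matrix G. *)

Definition box_vec (n N : nat) (f : {ffun 'I_n -> 'I_(N.*2.+1)}) : 'rV[R]_n :=
  \row_i ((f i)%:R - N%:R).

Definition sqnorm (n : nat) (v : 'rV[R]_n) : R := \sum_i (v ord0 i) ^+ 2.

(* theta series Theta_Lambda(z) = sum_{lambda} exp(i pi z ||lambda||^2), z = x + i y,
   y > 0, written componentwise: real and imaginary parts. The sum over Z^n is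
   the limit of the partial sums over the boxes [-N, N]^n (the series is
   absolutely convergent for y > 0). *)
Definition theta_re (n : nat) (G : 'M[R]_n) (x y : R) : R :=
  limn (fun N : nat => \sum_(f : {ffun 'I_n -> 'I_(N.*2.+1)})
     let r := sqnorm (box_vec f *m G) in expR (- pi * y * r) * cos (pi * x * r)).

Definition theta_im (n : nat) (G : 'M[R]_n) (x y : R) : R :=
  limn (fun N : nat => \sum_(f : {ffun 'I_n -> 'I_(N.*2.+1)})
     let r := sqnorm (box_vec f *m G) in expR (- pi * y * r) * sin (pi * x * r)).

Definition theta_imag_axis (n : nat) (G : 'M[R]_n) (tau : R) : R :=
  theta_re G 0 tau.

Definition dual_gen (n : nat) (G : 'M[R]_n) : 'M[R]_n := (invmx G)^T.

Definition vol (n : nat) (G : 'M[R]_n) : R := `|\det G|.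

Definition secrecy (n : nat) (G : 'M[R]_n) (tau : R) : R :=
  let nu := powR (vol G) (n%:R)^-1 in
  theta_imag_axis (nu%:M : 'M[R]_n) tau / theta_imag_axis G tau.

Definition formally_unimodular (n : nat) (G : 'M[R]_n) : Prop :=
  forall x y : R, 0 < y ->
    theta_re G x y = theta_re (dual_gen G) x y /\
    theta_im G x y = theta_im (dual_gen G) x y.

End Lattices.

(* Main.v *)
Require Import Defs.
From HB Require Import structures.
From mathcomp Require Import all_boot all_order all_algebra.
From mathcomp Require Import all_classical all_reals all_analysis.
From mathcomp Require Import ring lra zify.
Import Order.TTheory GRing.Theory Num.Theory.
Import numFieldNormedType.Exports.
Local Open Scope ring_scope.
Local Open Scope classical_set_scope.

Set Implicit Arguments.
Unset Strict Implicit.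

(** By Poisson summation, [Theta_G (i / tau) = tau ^ (n / 2) Theta_(G^* ) (i tau)] when
    the volume is 1.  The self-dual lattice Z^n satisfies the same formula, so the factors
    cancel in the secrecy function, and its symmetry says exactly that [Theta_G] and
    [Theta_(G^* )] agree on the imaginary axis.

    Poisson summation is obtained without integrals.  In dimension one, after Polya, it is
    the limit of a finite identity: sum the binomial expansion of [(2 cos y) ^ (2 m)] over
    [y = pi (l + s) / L], with [m] of order [L ^ 2].  Both sides tend to Gaussian sums, and
    the constant is found by comparing them where they coincide.  In dimension n, an
    orthogonal change of coordinates makes the generator block triangular; the first
    variable is transformed by the one-dimensional formula and the others by induction.

    Agreement passes from the imaginary axis to the half-plane because the sums of
    [exp (- pi k y r)], [k >= 1], are the positive moments of the variable
    [t = exp (- pi y r)]: Bernstein polynomials then give the sum of [t psi t] for every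
    bounded continuous [psi], and [psi t = cos (- (x / y) ln t)] is the case needed. *)

(** * Symmetric sums over the integers *)

Section SymmetricSums.
Variable R : realType.
Implicit Types (F g : int -> R).

(** Pairing opposite integers makes the partial sums grow one pair at a time, which suits induction;
    [isum_ordE] returns to the interval [-N, N]. *)
Definition isum (N : nat) F : R :=
  F 0 + \sum_(k < N) (F k.+1%:Z + F (- k.+1%:Z)).

Definition zsum F : R := limn (fun N => isum N F).

Lemma isumS N F : isum N.+1 F = isum N F + (F N.+1%:Z + F (- N.+1%:Z)).
Proof. by rewrite /isum big_ord_recr /= addrA. Qed.

Lemma isum_ordE N F : \sum_(i < N.*2.+1) F (i%:Z - N%:Z) = isum N F.
Proof.
elim: N => [|N IH]; first by rewrite big_ord1 /isum big_ord0 [RHS]addr0; congr F; lia.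
rewrite isumS -IH doubleS big_ord_recr big_ord_recl /=.
have -> : N.*2.+2%:Z - N.+1%:Z = N.+1%:Z by lia.
have -> : 0%:Z - N.+1%:Z = - N.+1%:Z by lia.
have -> : \sum_(i < N.*2.+1) F ((bump 0 i)%:Z - N.+1%:Z) =
  \sum_(i < N.*2.+1) F (i%:Z - N%:Z).
  by apply: eq_bigr => i _; congr F; rewrite /bump /=; lia.
ring.
Qed.

Lemma eq_isum N F g : F =1 g -> isum N F = isum N g.
Proof.
by move=> e; rewrite /isum e; congr (_ + _); apply: eq_bigr => k _; rewrite !e.
Qed.

Lemma isumD N F g : isum N (fun k => F k + g k) = isum N F + isum N g.
Proof. by rewrite -!isum_ordE big_split. Qed.

Lemma isumZ N (a : R) F : isum N (fun k => a * F k) = a * isum N F.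
Proof. by rewrite -!isum_ordE big_distrr. Qed.

Lemma ler_isum N F g : (forall k, (absz k <= N)%N -> F k <= g k) ->
  isum N F <= isum N g.
Proof.
move=> Fg; apply: lerD; first exact: Fg.
by apply: ler_sum => -[k kN] _ /=; apply: lerD; apply: Fg; lia.
Qed.

Lemma ler_norm_isum N F : `|isum N F| <= isum N (fun k => `|F k|).
Proof. by rewrite -!isum_ordE; exact: ler_norm_sum. Qed.

Lemma isum_ge_term N F : (forall k, 0 <= F k) -> F 0 <= isum N F.
Proof. by move=> F0; rewrite lerDl sumr_ge0// => k _; rewrite addr_ge0. Qed.

Lemma isum_le_mono g K N : (forall k, 0 <= g k) -> (K <= N)%N ->
  isum K g <= isum N g.
Proof.
move=> g0 /subnK<-; elim: (N - K)%N => // d IH; apply: le_trans IH _.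
by rewrite addSn isumS lerDl addr_ge0.
Qed.

Lemma isum_tail g F K N : (K <= N)%N ->
  (forall k, (absz k <= N)%N -> `|F k| <= g k) ->
  `|isum N F - isum K F| <= isum N g - isum K g.
Proof.
move=> /subnK<-; elim: (N - K)%N => [|d IH] Fg; first by rewrite add0n !subrr normr0.
rewrite addSn !isumS.
have {}IH := IH (fun k kd => Fg k (leqW kd)).
rewrite addrAC (addrAC (isum _ g)) (le_trans (ler_normD _ _))// lerD//.
by rewrite (le_trans (ler_normD _ _))// lerD//; apply: Fg; lia.
Qed.

Lemma cvg_isum_fin K (F_ : nat -> int -> R) F :
  (forall k, F_ ^~ k @ \oo --> F k) ->
  (fun N => isum K (F_ N)) @ \oo --> isum K F.
Proof.
move=> FF; elim: K => [|K IH].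
  have e N : isum 0 (F_ N) = F_ N 0 by rewrite /isum big_ord0 addr0.
  rewrite (_ : (fun N => _) = F_ ^~ 0); last exact/funext.
  by rewrite /isum big_ord0 addr0; exact: FF.
have e N : isum K.+1 (F_ N) = isum K (F_ N) + (F_ N K.+1%:Z + F_ N (- K.+1%:Z)).
  exact: isumS.
rewrite (_ : (fun N => _) = fun N => isum K (F_ N) + (F_ N K.+1%:Z + F_ N (- K.+1%:Z))); last exact/funext.
by rewrite isumS; apply: cvgD => //; apply: cvgD; exact: FF.
Qed.

Section Dominated.
Variables (g : int -> R) (M : R).
Hypothesis gM : forall N, isum N g <= M.

Lemma isum_cauchy (g0 : forall k, 0 <= g k) (e : R) : 0 < e ->
  exists K, forall N, (K <= N)%N -> isum N g - isum K g <= e.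
Proof.
move=> e0.
have ndg : nondecreasing_seq (fun N => isum N g).
  by move=> a b ab; exact: isum_le_mono.
have cg : cvgn (fun N => isum N g).
  by apply: nondecreasing_is_cvgn => //; exists M => _ [N _ <-].
have /cvgrPdist_le/(_ _ e0)[K _ HK] := cg.
exists K => N KN; have := HK K (leqnn K); rewrite /= => {}HK.
have le1 := nondecreasing_cvgn_le ndg cg.
rewrite (le_trans _ HK)//= ger0_norm ?subr_ge0//.
by rewrite lerD2r.
Qed.

Lemma isum_cvg F : (forall k, `|F k| <= g k) ->
  (fun N => isum N F) @ \oo --> zsum F.
Proof.
move=> Fg; have g0 k : 0 <= g k by exact: le_trans (Fg k).
apply: cauchy_cvg; apply: cauchy_exP => e e0.
have [K HK] := isum_cauchy g0 (divr_gt0 e0 (ltr0n R 2)).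
exists (isum K F); exists K => // N /= KN.
rewrite /ball /= distrC (@le_lt_trans _ _ (e / 2))//; last by lra.
by apply: le_trans (HK _ KN); exact: isum_tail.
Qed.

(** Tannery's theorem with a moving truncation: terms and range vary together, and the majorant is
    asked only inside the range. Finite identities pass to the limit in this form. *)
Lemma isum_dominated (B : nat -> nat) (F_ : nat -> int -> R) F :
  B @ \oo --> \oo ->
  (\forall N \near \oo, forall k, (absz k <= B N)%N -> `|F_ N k| <= g k) ->
  (forall k, F_ ^~ k @ \oo --> F k) ->
  (fun N => isum (B N) (F_ N)) @ \oo --> zsum F.
Proof.
move=> Binfty dom FF.
have Bge K : \forall N \near \oo, (K <= B N)%N.
  exact: (Binfty _ (nbhs_infty_ge K)).
have Fg k : `|F k| <= g k.
  have cn : (fun N => `|F_ N k|) @ \oo --> `|F k| by apply: cvg_norm; exact: FF.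
  apply: (cvgr_to_le cn).
  near=> N; have H : (absz k <= B N)%N by near: N; exact: Bge.
  exact: (near dom N).
have g0 k : 0 <= g k by exact: le_trans (Fg k).
apply/cvgrPdist_le => e e0.
(* Beyond [K] the majorant leaves at most [e / 3], for the limit and for every late [F_ N]; up to
   [K] the sum is finite. *)
have [K HK] := isum_cauchy g0 (divr_gt0 e0 (ltr0n R 3)).
have finK := cvg_isum_fin (K := K) FF.
have limF := isum_cvg Fg.
near=> N.
have h1 : `|zsum F - isum K F| <= e / 3.
  have cn : (fun N => `|isum N F - isum K F|) @ \oo --> `|zsum F - isum K F|.
    by apply: cvg_norm; apply: cvgB => //; exact: cvg_cst.
  apply: (cvgr_to_le cn); near=> n.
  have Kn : (K <= n)%N by near: n; exists K.
  by apply: le_trans (HK _ Kn); apply: isum_tail.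
have h2 : `|isum K F - isum K (F_ N)| <= e / 3.
  by near: N; move/cvgrPdist_le : finK; apply; rewrite divr_gt0.
have KB : (K <= B N)%N by near: N; exact: Bge.
have h3 : `|isum (B N) (F_ N) - isum K (F_ N)| <= e / 3.
  apply: le_trans (HK _ KB); apply: isum_tail => // k kB.
  exact: (near dom N).
rewrite (_ : _ - _ = (zsum F - isum K F) + (isum K F - isum K (F_ N))
   - (isum (B N) (F_ N) - isum K (F_ N))); last by ring.
rewrite (le_trans (ler_normB _ _))//.
have := ler_normD (zsum F - isum K F) (isum K F - isum K (F_ N)).
lra.
Unshelve. all: by end_near. Qed.

End Dominated.

End SymmetricSums.

(** * A finite form of the Jacobi identity *)

Section FiniteIdentity.
Variable R : realType.
Implicit Types (F g : int -> R) (x y s th : R).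

Lemma natr_doubleS (n : nat) : n.*2.+1%:R = n%:R * 2 + 1 :> R.
Proof. by rewrite -addn1 natrD -muln2 natrM. Qed.

Lemma sin_pi_int (a : int) : sin (pi * a%:~R) = 0 :> R.
Proof.
have H (n : nat) : sin (pi * n%:R) = 0 :> R.
  by rewrite mulr_natr -[pi *+ n]add0r (alternatingn (@sinDpi R)) sin0 mulr0.
by case: a => n; [exact: H | rewrite NegzE mulrNz mulrN sinN H oppr0].
Qed.

Lemma cos_2pi_int (a : int) : cos (2 * pi * a%:~R) = 1 :> R.
Proof.
rewrite -mulrA mulr_natl cos_mulr2n cos2sin2 sin_pi_int expr0n/= subr0.
by rewrite mulr2n addrK.
Qed.

Lemma sin_2pi_int (a : int) : sin (2 * pi * a%:~R) = 0 :> R.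
Proof. by rewrite -mulrA mulr_natl sin_mulr2n sin_pi_int mulr0 mul0rn. Qed.

Lemma cosD2pi_int x (a : int) : cos (x + 2 * pi * a%:~R) = cos x.
Proof. by rewrite cosD cos_2pi_int sin_2pi_int mulr1 mulr0 subr0. Qed.

(** Reducing [q] modulo [n] puts the angle strictly between 0 and pi, up to a multiple of pi that
    changes at most the sign. *)
Lemma sin_pi_ratio_neq0 (n : nat) (q : int) : (0 < n)%N -> ~~ (n%:Z %| q)%Z ->
  sin (pi * q%:~R / n%:R) != 0 :> R.
Proof.
move=> n0 nq.
have nR0 : 0 < n%:R :> R by rewrite ltr0n.
set a := (q %/ n%:Z)%Z; set r := (q %% n%:Z)%Z.
have qE : q = a * n%:Z + r by exact: divz_eq.
have r0 : 0 < r.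
  have rn0 : r != 0 by apply: contra nq => /eqP r0; apply/dvdz_mod0P.
  by rewrite lt_neqAle eq_sym rn0 modz_ge0//; lia.
have rn : r < n%:Z by rewrite ltz_pmod// ltz_nat.
have -> : pi * q%:~R / n%:R = pi * r%:~R / n%:R + pi * a%:~R :> R.
  by rewrite qE intrD intrM; field; rewrite gt_eqF.
rewrite sinD sin_pi_int mulr0 addr0 mulf_neq0//.
  rewrite gt_eqF// sin_gt0_pi//; apply/andP; split.
    by rewrite divr_gt0// mulr_gt0 ?pi_gt0// ltr0z.
  rewrite ltr_pdivrMr// ltr_pM2l ?pi_gt0//.
  by rewrite (_ : n%:R = n%:Z%:~R)// ltr_int.
apply/eqP => c0; have := cos2Dsin2 (pi * a%:~R : R).
by rewrite c0 sin_pi_int expr0n/= addr0 => /esym/eqP; rewrite oner_eq0.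
Qed.

(** The Dirichlet kernel: each product is a difference of two sines taken half a step away, and the
    sum telescopes. *)
Lemma isum_cos_telescope N (al be : R) :
  2 * sin (al / 2) * isum N (fun l => cos (al * l%:~R + be)) =
  sin (al * (N%:R + 2^-1) + be) - sin (- (al * (N%:R + 2^-1)) + be).
Proof.
have key x : 2 * sin (al / 2) * cos x = sin (x + al / 2) - sin (x - al / 2).
  by rewrite sinD sinB; ring.
elim: N => [|N IH].
  rewrite /isum big_ord0 addr0 key mulr0z mulr0 !add0r.
  by congr (sin _ - sin _); ring.
rewrite isumS mulrDr {}IH [X in _ + X]mulrDr !key intrN.
rewrite (_ : N.+1%:Z%:~R = N%:R + 1 :> R); last by rewrite -pmulrn -addn1 natrD.
rewrite (_ : al * (N%:R + 1) + be - al / 2 = al * (N%:R + 2^-1) + be); last by field.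
rewrite (_ : al * (N%:R + 1) + be + al / 2 = al * (N%:R + 1 + 2^-1) + be); last by field.
rewrite (_ : al * - (N%:R + 1) + be + al / 2 = - (al * (N%:R + 2^-1)) + be); last by field.
rewrite (_ : al * - (N%:R + 1) + be - al / 2 = - (al * (N%:R + 1 + 2^-1)) + be); last by field.
rewrite (_ : N.+1%:R = N%:R + 1); last by rewrite -[N.+1]addn1 natrD.
ring.
Qed.

Lemma isum_cst N (a : R) : isum N (fun=> a) = N.*2.+1%:R * a.
Proof. by rewrite -isum_ordE sumr_const card_ord mulr_natl. Qed.

(** Orthogonality of the characters of Z / L, with an offset and a phase; as [L] is odd, the
    symmetric interval is a full set of residues. *)
Lemma isum_cos_char N (q : int) s th : let L := N.*2.+1 in
  isum N (fun l => cos (2 * pi * q%:~R * (l%:~R + s) / L%:R + th)) =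
  if (L%:Z %| q)%Z then L%:R * cos (2 * pi * q%:~R * s / L%:R + th) else 0.
Proof.
move=> L; have L0 : L%:R != 0 :> R by rewrite pnatr_eq0.
case: ifPn => [/dvdzP[a qE]|nq].
  rewrite -isum_cst; apply: eq_isum => l; rewrite -[RHS](cosD2pi_int _ (a * l)).
  by congr cos; rewrite qE !intrM -pmulrn; field.
set al := 2 * pi * q%:~R / L%:R : R.
rewrite (_ : isum N _ = isum N (fun l => cos (al * l%:~R + (al * s + th)))); last first.
  by apply: eq_isum => l; congr cos; rewrite /al; ring.
have al2 : al / 2 = pi * q%:~R / L%:R by rewrite /al; field.
have := isum_cos_telescope N al (al * s + th).
(* As [L = 2 N + 1], the boundary angle is [pi q], where sine vanishes; the two boundary terms are
   then equal. *)
rewrite (_ : al * (N%:R + 2^-1) = pi * q%:~R); last first.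
  have -> : N%:R + 2^-1 = L%:R / 2 :> R.
    by rewrite /L natr_doubleS; field.
  by rewrite /al; field.
rewrite al2 sinD sin_pi_int (sinD (- _)) sinN cosN sin_pi_int.
rewrite oppr0 !mul0r !add0r subrr => /eqP; rewrite mulf_eq0 mulf_eq0 pnatr_eq0/=.
by rewrite (negPf (sin_pi_ratio_neq0 _ nq))//= => /eqP.
Qed.

Lemma sum_bin_recr M (f : nat -> R) :
  \sum_(i < M.+2) 'C(M.+1, i)%:R * f i =
  \sum_(i < M.+1) 'C(M, i)%:R * (f i + f i.+1).
Proof.
rewrite big_ord_recl /= bin0 mul1r.
under [in RHS]eq_bigr do rewrite mulrDr.
rewrite big_split /= [X in _ = X + _]big_ord_recl /= bin0 mul1r -addrA; congr (_ + _).
have -> : \sum_(i < M) 'C(M, bump 0 i)%:R * f (bump 0 i) =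
  \sum_(i < M.+1) 'C(M, i.+1)%:R * f i.+1.
  by rewrite big_ord_recr /= bin_small// mul0r addr0.
rewrite -big_split /=; apply: eq_bigr => i _.
by rewrite /bump/= add1n binS natrD mulrDl.
Qed.

(** Induction on [M] through [2 cos y cos A = cos (A + y) + cos (A - y)]. The free phase [th]
    replaces complex exponentials. *)
Lemma cos_pow_expand M y th :
  (2 * cos y) ^+ M * cos th =
  \sum_(i < M.+1) 'C(M, i)%:R * cos (th + (M%:R - i%:R * 2) * y).
Proof.
elim: M => [|M IH].
  by rewrite big_ord1 expr0 bin0; congr (_ * cos _); rewrite /=; ring.
rewrite (sum_bin_recr M (fun i => cos (th + (M.+1%:R - i%:R * 2) * y))).
rewrite exprS -mulrA IH big_distrr /=; apply: eq_bigr => i _.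
rewrite mulrCA; congr (_ * _); rewrite -[M.+1%:R]natr1 -[i.+1%:R]natr1.
rewrite (_ : th + (M%:R + 1 - i%:R * 2) * y = th + (M%:R - i%:R * 2) * y + y); last by ring.
rewrite (_ : th + (M%:R + 1 - (i%:R + 1) * 2) * y = th + (M%:R - i%:R * 2) * y - y); last by ring.
by set A := th + _; rewrite cosD cosB; ring.
Qed.

Lemma isum_delta B (k0 : int) F : (absz k0 <= B)%N ->
  isum B (fun k => if k == k0 then F k else 0) = F k0.
Proof.
move=> k0B; rewrite -isum_ordE.
have lt0 : (absz (k0 + B%:Z)%R < B.*2.+1)%N by lia.
rewrite (bigD1 (Ordinal lt0)) //= ifT; last by lia.
rewrite big1 ?addr0; first by congr F; lia.
move=> i /eqP ne; rewrite ifF//; apply/eqP => e; apply: ne; apply: val_inj => /=.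
by lia.
Qed.

Lemma isum_sum B n (f : 'I_n -> int -> R) :
  isum B (fun k => \sum_(i < n) f i k) = \sum_(i < n) isum B (f i).
Proof.
rewrite -isum_ordE exchange_big; apply: eq_bigr => i _.
by rewrite isum_ordE.
Qed.

(** This collects the expansion by frequency: in units of [2 y], its term [i] has frequency
    [p + m - i]. The absolute value reflects the symmetry of row [2 m]; outside the row both sides
    vanish. *)
Lemma bin_shift_delta m (p j : int) :
  'C(m.*2, (m + absz (j - p)%R)%N)%:R =
  \sum_(i < m.*2.+1) 'C(m.*2, i)%:R * (p + m%:Z - i%:Z == j)%:R :> R.
Proof.
have [h|h] := leqP (absz (j - p)) m; last first.
  rewrite bin_small; last by lia.
  rewrite big1// => -[i ib] _ /=.
  by rewrite (_ : (_ == j) = false) ?mulr0//; apply/eqP; lia.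
have lt0 : (absz (p + m%:Z - j)%R < m.*2.+1)%N by lia.
rewrite (bigD1 (Ordinal lt0))//= big1 ?addr0; last first.
  move=> i /eqP ne; rewrite (_ : (_ == j) = false) ?mulr0//.
  by apply/eqP => e; apply: ne; apply: val_inj => /=; lia.
rewrite (_ : (_ == j) = true) ?mulr1; last by apply/eqP; lia.
congr (_%:R); have [jp|jp] := leP p j.
  by rewrite -bin_sub; [congr 'C(_, _); lia|lia].
by congr 'C(_, _); lia.
Qed.

(* Evaluate both sides of the binomial expansion of (2 cos y)^(2m) cos(2 p y + th) *)
(* at the L points y = pi (l + s) / L; only frequencies divisible by L survive.   *)
Lemma polya_identity N m B (p : int) s th : let L := N.*2.+1 in
  (m + absz p <= B)%N ->
  isum N (fun l => (2 * cos (pi * (l%:~R + s) / L%:R)) ^+ m.*2 *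
                   cos (2 * pi * p%:~R * (l%:~R + s) / L%:R + th)) =
  L%:R * isum B (fun k => 'C(m.*2, (m + absz (L%:Z * k - p)%R)%N)%:R *
                          cos (2 * pi * k%:~R * s + th)).
Proof.
move=> L mB; have L0 : L%:R != 0 :> R by rewrite pnatr_eq0.
have e1 (l : int) : (2 * cos (pi * (l%:~R + s) / L%:R)) ^+ m.*2 *
    cos (2 * pi * p%:~R * (l%:~R + s) / L%:R + th) =
  \sum_(i < m.*2.+1) 'C(m.*2, i)%:R *
    cos (2 * pi * (p + m%:Z - i%:Z)%:~R * (l%:~R + s) / L%:R + th).
  rewrite cos_pow_expand; apply: eq_bigr => i _; congr (_ * cos _).
  have -> : m.*2%:R = m%:R * 2 :> R by rewrite -muln2 natrM.
  by rewrite !intrD intrN -!pmulrn; field.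
rewrite (eq_isum _ e1) isum_sum.
have e2 (k : int) : 'C(m.*2, (m + absz (L%:Z * k - p)%R)%N)%:R * cos (2 * pi * k%:~R * s + th) =
   \sum_(i < m.*2.+1) 'C(m.*2, i)%:R * ((p + m%:Z - i%:Z == L%:Z * k)%:R
       * cos (2 * pi * k%:~R * s + th)).
  by rewrite bin_shift_delta big_distrl; apply: eq_bigr => i _; rewrite mulrA.
rewrite (eq_isum _ e2) isum_sum big_distrr; apply: eq_bigr => -[i ib] _ /=.
rewrite !isumZ mulrCA; congr (_ * _).
rewrite isum_cos_char -/L; set q : int := p + m%:Z - i%:Z.
case: ifPn => [/dvdzP[a qE]|nq].
  congr (_ * _).
  (* In absolute value [a] is at most [q = a L], hence at most [m + |p|], so the surviving index
     lies in the range of summation. *)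
  have aB : (absz a <= B)%N.
    have : (absz q <= B)%N by rewrite /q; lia.
    by rewrite qE abszM; apply: leq_trans; rewrite /L/= leq_pmulr.
  rewrite -[LHS](_ : cos (2 * pi * a%:~R * s + th) = _); last first.
    by congr cos; rewrite qE intrM -pmulrn; field.
  rewrite -(@isum_delta B a (fun k => cos (2 * pi * k%:~R * s + th)))//.
  apply: eq_isum => k; rewrite qE (mulrC a) (inj_eq (mulfI _))// eq_sym.
  by case: eqP => _; rewrite ?mul1r ?mul0r.
rewrite (_ : isum B _ = 0) ?mulr0//.
rewrite (@eq_isum _ B _ (fun=> 0)) ?isum_cst ?mulr0// => k.
rewrite (_ : (q == _) = false) ?mul0r//; apply/eqP => qE.
by move: nq; rewrite qE dvdz_mulr.
Qed.

End FiniteIdentity.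

(** * Asymptotics *)

Section Asymptotics.
Variable R : realType.
Implicit Types (F : int -> R) (a b c s t x y th : R).

Definition gauss c (k : int) : R := expR (- c * k%:~R ^+ 2).

(** Since [|k| <= k ^ 2], the comparison is with a two-sided geometric series. *)
Lemma isum_gauss_bounded c : 0 < c -> exists M, forall N, isum N (gauss c) <= M.
Proof.
move=> c0; set q := expR (- c).
have q0 : 0 < q by exact: expR_gt0.
have q1 : 0 < 1 - q by rewrite subr_gt0 expR_lt1 oppr_lt0.
exists (1 + 2 / (1 - q)) => N.
have gq (k : int) : gauss c k <= q ^+ absz k.
  rewrite /gauss /q -expRM_natr ler_expR !mulNr lerN2 ler_pM2l//.
  have -> : k%:~R ^+ 2 = (absz k ^ 2)%:R :> R.
    by rewrite [RHS]pmulrn -rmorphXn; congr _%:~R; lia.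
  by rewrite ler_nat -mulnn; case: (absz k) => // n; rewrite leq_pmulr.
have H : isum N (fun k => q ^+ absz k) <= 1 + 2 * (1 - q ^+ N) / (1 - q).
  elim: N => [|N IH]; first by rewrite /isum big_ord0 absz0 !expr0 addr0 subrr mulr0 mul0r addr0.
  rewrite isumS (le_trans (lerD IH (lexx _)))// abszN absz_nat -addrA lerD2l.
  rewrite -lerBrDl -mulrBl ler_pdivlMr// exprS.
  have : 0 <= q ^+ N * (1 - q) ^+ 2 by rewrite mulr_ge0 ?sqr_ge0// ltW// exprn_gt0.
  lra.
apply: le_trans (ler_isum (fun k _ => gq k)) (le_trans H _).
rewrite lerD2l ler_pM2r ?invr_gt0// ger_pMr// gerBl exprn_ge0// ltW//.
Qed.

Lemma isum_gauss_dominated c C (B : nat -> nat) (F_ : nat -> int -> R) F :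
  0 < c -> B @ \oo --> \oo ->
  (\forall N \near \oo, forall k, (absz k <= B N)%N ->
     `|F_ N k| <= C * gauss c k) ->
  (forall k, F_ ^~ k @ \oo --> F k) ->
  (fun N => isum (B N) (F_ N)) @ \oo --> zsum F.
Proof.
move=> c0 Boo dom FF; have [M gM] := isum_gauss_bounded c0.
apply: (@isum_dominated _ (fun k => `|C| * gauss c k) (`|C| * M)) => //.
  by move=> N; rewrite isumZ ler_wpM2l.
near=> N => k kB; rewrite (@le_trans _ _ (C * gauss c k))//.
  exact: (near dom N).
by rewrite ler_wpM2r ?expR_ge0// ler_norm.
Unshelve. all: by end_near. Qed.

Lemma isum_gauss_cvg c C F : 0 < c -> (forall k, `|F k| <= C * gauss c k) ->
  (fun N => isum N F) @ \oo --> zsum F.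
Proof.
move=> c0 FC; apply: (isum_gauss_dominated (B := id) (F_ := fun=> F) c0).
- exact: cvg_id.
- by near=> N => k _; exact: FC.
- by move=> k; exact: cvg_cst.
Unshelve. all: by end_near. Qed.

(** Squeeze between [exp (- m e / (1 - e))] and [exp (- m e)]. Both bounds come from
    [1 + x <= exp x], the lower one at [x = e / (1 - e)]. *)
Lemma cvg_one_sub_pow (m : nat -> nat) (e : nat -> R) a :
  (forall N, 0 <= e N) -> e @ \oo --> (0 : R) ->
  (fun N => (m N)%:R * e N) @ \oo --> a ->
  (fun N => (1 - e N) ^+ m N) @ \oo --> expR (- a).
Proof.
move=> e0 ce cme.
have e_lt : \forall N \near \oo, e N < 1 / 2.
  by apply: (cvgr_lt _ ce); rewrite divr_gt0.
apply: (@squeeze_cvgr _ _ _ _ (fun N => expR (- ((m N)%:R * e N / (1 - e N)))) (fun N => expR (- ((m N)%:R * e N)))).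
- near=> N.
  have eN : e N < 1 / 2 by near: N.
  have e1 : 0 < 1 - e N by lra.
  have e1' := ltW e1.
  apply/andP; split; last first.
    rewrite -mulrN expRM_natl lerXn2r ?nnegrE ?expR_ge0//.
    exact: expR_ge1Dx.
  rewrite -mulrA -mulrN expRM_natl lerXn2r ?nnegrE ?expR_ge0//.
  rewrite expRN -[leRHS]invrK lef_pV2 ?posrE ?invr_gt0 ?expR_gt0//.
  rewrite (le_trans _ (expR_ge1Dx _))//.
  by rewrite le_eqVlt; apply/orP; left; apply/eqP; field; rewrite gt_eqF.
- apply: continuous_cvg; first exact: continuous_expR.
  apply: cvgN; rewrite -[a]divr1; apply: cvgM => //.
  apply: cvgV; first exact: oner_neq0.
  by rewrite -[X in _ --> X]subr0; apply: cvgB => //; exact: cvg_cst.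
- by apply: continuous_cvg; [exact: continuous_expR|exact: cvgN].
Unshelve. all: by end_near. Qed.

(** By the mean value theorem [sin y = y cos xi] with [xi] between 0 and [y], and cosine decreases
    on [0, pi]. *)
Lemma sin_bounds y : 0 <= y <= pi -> y * cos y <= sin y <= y.
Proof.
move=> /andP[]; rewrite le_eqVlt => /orP[/eqP<- _|y0 ypi].
  by rewrite mul0r sin0 lexx.
have [|xi] := @MVT R sin cos 0 y y0 (fun x _ => is_derive_sin x).
  by apply: continuous_subspaceT => x; exact: continuous_sin.
rewrite in_itv/= sin0 !subr0 => /andP[xi0 xiy] ->.
rewrite mulrC ler_pM2r// ger_pMl// cos_le1 andbT.
by rewrite le_eqVlt (ltr_cos _ _) ?xiy ?orbT// in_itv/= ?(ltW xi0) ?(ltW y0) ?ypi// (le_trans (ltW xiy)).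
Qed.

Lemma sin_sqr_bounds y : `|y| <= pi / 2 ->
  y ^+ 2 * cos y ^+ 2 <= sin y ^+ 2 <= y ^+ 2.
Proof.
wlog y0 : y / 0 <= y => [H yp|].
  have [y0|y0] := leP 0 y; first exact: H.
  have := H (- y); rewrite normrN sinN cosN !sqrrN oppr_ge0; apply => //.
  exact: ltW.
rewrite ger0_norm// => yp; have pi0 := @pi_gt0 R.
have /sin_bounds/andP[l u] : 0 <= y <= pi by apply/andP; split=> //; lra.
have c0 : 0 <= cos y by apply: cos_ge0_pihalf; apply/andP; split; lra.
have s0 : 0 <= sin y by rewrite (le_trans _ l)// mulr_ge0.
by rewrite -exprMn !lerXn2r ?nnegrE ?mulr_ge0.
Qed.

(* Any positive constant valid a little beyond [-pi/2, pi/2] would do. *)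
Lemma sin_sqr_lower : exists2 c : R, 0 < c &
  forall y, `|y| <= 3 * pi / 4 -> c * y ^+ 2 <= sin y ^+ 2.
Proof.
have pi0 := @pi_gt0 R.
have cd0 : 0 < cos (3 * pi / 8 : R) by apply: cos_gt0_pihalf; apply/andP; split; lra.
exists ((cos (3 * pi / 8) ^+ 2) ^+ 2); first by rewrite !exprn_gt0.
move=> y; wlog y0 : y / 0 <= y => [H yp|].
  have [y0|y0] := leP 0 y; first exact: H.
  have := H (- y); rewrite normrN sinN !sqrrN oppr_ge0; apply => //.
  exact: ltW.
rewrite ger0_norm// => yp.
(* The half-angle is at most [3 pi / 8], where cosine is positive. The bound serves twice: for
   [cos (y / 2)], and in [sin (y / 2) >= (y / 2) cos (y / 2)]. *)
have cz : cos (3 * pi / 8) <= cos (y / 2).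
  rewrite le_eqVlt orbC; case: (ltrP (y / 2) (3 * pi / 8)) => [yl|yl].
    by rewrite (ltr_cos _ _) ?yl// in_itv/=; apply/andP; split; lra.
  by rewrite (_ : y / 2 = 3 * pi / 8) ?eqxx ?orbT//; lra.
have /sin_bounds/andP[l _] : 0 <= y / 2 <= pi by apply/andP; split; lra.
have sE : sin y = 2 * (cos (y / 2) * sin (y / 2)).
  by rewrite mulr_natl -sin_mulr2n; congr sin; rewrite mulr2n; field.
have s1 : cos (3 * pi / 8) ^+ 2 * y <= sin y.
  rewrite sE; set k := cos (3 * pi / 8) in cd0 cz *.
  rewrite (@le_trans _ _ (2 * (k * (y / 2 * k))))//.
    by rewrite le_eqVlt; apply/orP; left; apply/eqP; field.
  rewrite ler_pM2l// ler_pM//; [exact: ltW|by rewrite mulr_ge0// ?divr_ge0// ltW|].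
  by rewrite (le_trans _ l)// ler_wpM2l// divr_ge0.
have s0 : 0 <= cos (3 * pi / 8) ^+ 2 * y by rewrite mulr_ge0// sqr_ge0.
by rewrite -exprMn lerXn2r ?nnegrE// (le_trans s0).
Qed.

End Asymptotics.

(** * Gaussian behaviour of binomial coefficients near the centre *)

Section Binomial.
Variable R : realType.
Implicit Types (m q D : nat).

Lemma central_bin_gt0 m : 0 < 'C(m.*2, m)%:R :> R.
Proof. by rewrite ltr0n bin_gt0 -addnn leq_addl. Qed.

Lemma bin_step m q : (q < m)%N ->
  'C(m.*2, (m + q.+1)%N)%:R =
  'C(m.*2, (m + q)%N)%:R * ((m%:R - q%:R) / (m%:R + q%:R + 1)) :> R.
Proof.
move=> qm; have := mul_bin_left m.*2 (m + q).
rewrite (_ : m.*2 - (m + q) = m - q)%N; last by lia.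
move=> /(congr1 (fun n : nat => n%:R : R)).
rewrite !natrM natrB 1?ltnW// addnS -natr1 natrD => e.
have d0 : m%:R + q%:R + 1 != 0 :> R by rewrite -natrD natr1 pnatr_eq0.
apply: (mulfI d0); rewrite e; field.
exact: d0.
Qed.

(** Each ratio is [1 - (2 q + 1) / (m + q + 1)], at most [exp (- (2 q + 1) / D)], and the odd
    numbers add up to [q ^ 2]. [D = m + q] will give the sharp limit, [D = 2 m] a bound uniform in
    [q]. *)
Lemma bin_upper m q D : (0 < D)%N -> (m + q <= D)%N ->
  'C(m.*2, (m + q)%N)%:R <= 'C(m.*2, m)%:R * expR (- (q%:R ^+ 2 / D%:R)) :> R.
Proof.
move=> D0; have DR : 0 < D%:R :> R by rewrite ltr0n.
elim: q => [|q IH] qD; first by rewrite addn0 expr0n/= mul0r oppr0 expR0 mulr1.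
have [mq|qm] := leqP m q.
  by rewrite bin_small ?mulr_ge0 ?expR_ge0//; lia.
rewrite bin_step//.
have {}IH := IH ltac:(lia).
have d0 : 0 < m%:R + q%:R + 1 :> R by rewrite -natrD natr1 ltr0n.
have dD : m%:R + q%:R + 1 <= D%:R :> R by rewrite -natrD natr1 ler_nat; lia.
have fle : (m%:R - q%:R) / (m%:R + q%:R + 1) <= expR (- ((q%:R * 2 + 1) / D%:R)) :> R.
  apply: (@le_trans _ _ (1 + - ((q%:R * 2 + 1) / D%:R))); last exact: expR_ge1Dx.
  rewrite (_ : (m%:R - q%:R) / (m%:R + q%:R + 1) = 1 - (q%:R * 2 + 1) / (m%:R + q%:R + 1)); last by field; rewrite gt_eqF.
  by rewrite lerD2l lerN2 ler_wpM2l ?lef_pV2 ?posrE// -natrM natr1.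
rewrite (_ : expR (- (q.+1%:R ^+ 2 / D%:R)) =
  expR (- (q%:R ^+ 2 / D%:R)) * expR (- ((q%:R * 2 + 1) / D%:R))); last first.
  by rewrite -expRD -[q.+1%:R]natr1; congr expR; field; rewrite gt_eqF.
rewrite [leRHS]mulrA; apply: (ler_pM _ _ IH fle); first exact: ler0n.
by rewrite divr_ge0 ?(ltW d0)// subr_ge0 ler_nat ltnW.
Qed.

(** The inverse ratios are [1 + (2 q + 1) / (m - q)], at most [exp ((2 q + 1) / D)] when
    [D <= m - q]. *)
Lemma bin_lower m q D : (0 < D)%N -> (D + q <= m)%N ->
  'C(m.*2, m)%:R * expR (- (q%:R ^+ 2 / D%:R)) <= 'C(m.*2, (m + q)%N)%:R :> R.
Proof.
move=> D0; have DR : 0 < D%:R :> R by rewrite ltr0n.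
elim: q => [|q IH] qD; first by rewrite addn0 expr0n/= mul0r oppr0 expR0 mulr1.
have qm : (q < m)%N by lia.
rewrite bin_step//.
have {}IH := IH ltac:(lia).
have d0 : 0 < m%:R + q%:R + 1 :> R by rewrite -natrD natr1 ltr0n.
have dm : 0 < m%:R - q%:R :> R by rewrite subr_gt0 ltr_nat.
have dD : D%:R <= m%:R - q%:R :> R by rewrite -natrB ?ler_nat 1?ltnW//; lia.
have fle : expR (- ((q%:R * 2 + 1) / D%:R)) <= (m%:R - q%:R) / (m%:R + q%:R + 1) :> R.
  rewrite expRN -[leRHS]invrK lef_pV2 ?posrE ?expR_gt0 ?invr_gt0 ?divr_gt0//.
  apply: (@le_trans _ _ (1 + ((q%:R * 2 + 1) / D%:R))); last exact: expR_ge1Dx.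
  rewrite invf_div (_ : (m%:R + q%:R + 1) / (m%:R - q%:R) = 1 + (q%:R * 2 + 1) / (m%:R - q%:R)); last by field; rewrite gt_eqF.
  by rewrite lerD2l ler_wpM2l ?lef_pV2 ?posrE// -natrM natr1.
rewrite (_ : expR (- (q.+1%:R ^+ 2 / D%:R)) =
  expR (- (q%:R ^+ 2 / D%:R)) * expR (- ((q%:R * 2 + 1) / D%:R))); last first.
  by rewrite -expRD -[q.+1%:R]natr1; congr expR; field; rewrite gt_eqF.
by rewrite mulrA ler_pM// ?expR_ge0 ?mulr_ge0 ?expR_ge0.
Qed.

(** The local limit of de Moivre and Laplace, squeezed by [bin_lower] with [D = m - q] and
    [bin_upper] with [D = m + q], whose ratios to [m] tend to 1. *)
Lemma cvg_bin_ratio (m q : nat -> nat) (a : R) :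
  (fun N => (m N)%:R^-1 : R) @ \oo --> (0 : R) ->
  (\forall N \near \oo, (0 < m N)%N) ->
  (fun N => (q N)%:R ^+ 2 / (m N)%:R : R) @ \oo --> a ->
  (fun N => 'C((m N).*2, (m N + q N)%N)%:R / 'C((m N).*2, m N)%:R : R) @ \oo
    --> expR (- a).
Proof.
move=> cm m0 cq.
pose r N : R := (q N)%:R / (m N)%:R.
(* The square of [q / m] is [(q ^ 2 / m) / m], which tends to 0. *)
have cr : r @ \oo --> (0 : R).
  have c2 : (fun N => (r N) ^+ 2) @ \oo --> (0 : R).
    rewrite -(mulr0 a) (_ : (fun N => _) = (fun N => (q N)%:R ^+ 2 / (m N)%:R * (m N)%:R^-1)).
      exact: cvgM.
    by apply/funext => N; rewrite /r expr_div_n expr2 (expr2 (m N)%:R) invfM; ring.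
  apply/norm_cvg0P; rewrite (_ : (fun x => _) = Num.sqrt \o (fun N => r N ^+ 2)); last first.
    by apply/funext => N /=; rewrite sqrtr_sqr.
  rewrite -(@sqrtr0 R); apply: continuous_cvg => //; exact: sqrt_continuous.
have r1 : \forall N \near \oo, r N < 1 by exact: (cvgr_lt _ cr).
apply: (@squeeze_cvgr _ _ _ _
  (fun N => expR (- ((q N)%:R ^+ 2 / (m N)%:R / (1 - r N))))
  (fun N => expR (- ((q N)%:R ^+ 2 / (m N)%:R / (1 + r N))))).
- near=> N.
  have mN : (0 < m N)%N by near: N.
  have mR : 0 < (m N)%:R :> R by rewrite ltr0n.
  have rN : r N < 1 by near: N.
  have qm : (q N < m N)%N by move: rN; rewrite /r ltr_pdivrMr// mul1r ltr_nat.
  have C0 := central_bin_gt0 (m N).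
  rewrite ler_pdivlMr// ler_pdivrMr// ![expR _ * _]mulrC.
  have e1 : (q N)%:R ^+ 2 / (m N)%:R / (1 - r N) = (q N)%:R ^+ 2 / (m N - q N)%:R :> R.
    rewrite natrB 1?ltnW// /r; field; rewrite !gt_eqF//.
    by rewrite subr_gt0 ltr_nat.
  have e2 : (q N)%:R ^+ 2 / (m N)%:R / (1 + r N) = (q N)%:R ^+ 2 / (m N + q N)%:R :> R.
    rewrite natrD /r; field; rewrite !gt_eqF//.
    by rewrite -natrD ltr0n; lia.
  by rewrite e1 e2 bin_lower ?bin_upper//; lia.
- apply: continuous_cvg; first exact: continuous_expR.
  apply: cvgN; rewrite -[X in _ --> X]divr1; apply: cvgM => //.
  apply: cvgV; first exact: oner_neq0.
  by rewrite -[X in _ --> X]subr0; apply: cvgB => //; exact: cvg_cst.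
- apply: continuous_cvg; first exact: continuous_expR.
  apply: cvgN; rewrite -[X in _ --> X]divr1; apply: cvgM => //.
  apply: cvgV; first exact: oner_neq0.
  by rewrite -[X in _ --> X]addr0; apply: cvgD => //; exact: cvg_cst.
Unshelve. all: by end_near. Qed.

(* By Wallis the limit is 1 / pi; the Jacobi identity at t = 1 will give it. *)
Lemma central_bin_cvg :
  cvgn (fun m => m%:R * ('C(m.*2, m)%:R / 4 ^+ m) ^+ 2 : R).
Proof.
pose u m : R := 'C(m.*2, m)%:R / 4 ^+ m.
have u0 m : 0 < u m by rewrite divr_gt0 ?central_bin_gt0// exprn_gt0.
have uS m : u m.+1 = u m * ((2 * m%:R + 1) / (2 * m%:R + 2)).
  have d1 : m%:R + 1 != 0 :> R by rewrite natr1 pnatr_eq0.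
  have e : ((m.+1) * 'C(m.+1.*2, m.+1) = 2 * (2 * m + 1) * 'C(m.*2, m))%N.
    have e1 := mul_bin_diag m.*2.+2 m; have e2 := mul_bin_down m.*2.+1 m.
    rewrite /= (_ : m.*2.+1 - m = m.+1)%N in e2; last by lia.
    rewrite doubleS -e1 /= (_ : m.*2.+2 = 2 * m.+1)%N; last by lia.
    by rewrite -mulnA -e2 mulnA; congr (_ * _)%N; lia.
  rewrite /u exprS; apply: (mulfI d1).
  move: e => /(congr1 (fun n : nat => n%:R : R)); rewrite !natrM natrD natrM -natr1 => e.
  by rewrite mulrA e; field; rewrite expf_neq0 ?andbT ?pnatr_eq0 // gt_eqF // ltr_wpDl // mulr_ge0.
have sq m (x : R) :
  (x * ((2 * m%:R + 1) / (2 * m%:R + 2))) ^+ 2 =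
  x ^+ 2 * ((2 * m%:R + 1) ^+ 2 / (2 * m%:R + 2) ^+ 2) by rewrite !exprMn exprVn.
have den0 m : 0 < (2 * m%:R + 2 : R) ^+ 2 by rewrite exprn_gt0// ltr_wpDl// mulr_ge0.
apply: nondecreasing_is_cvgn.
  apply/nondecreasing_seqP => m; rewrite -/(u m) -/(u m.+1) uS sq.
  rewrite [leRHS]mulrCA [leLHS]mulrC ler_wpM2l ?sqr_ge0// mulrA ler_pdivlMr// -[m.+1%:R]natr1.
  have : 0 <= m%:R :> R by [].
  by move: m%:R => x; nra.
exists 1 => _ [m _ <-]; rewrite -/(u m).
(* This quantity is 1 at [m = 0] and does not increase, because
   [(2 m + 3) (2 m + 1) <= (2 m + 2) ^ 2]. *)
have : (2 * m%:R + 1) * u m ^+ 2 <= 1.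
  elim: m => [|m IH]; first by rewrite /u bin0 expr0 divr1 expr1n mulr0 add0r mulr1.
  rewrite uS sq mulrCA.
  apply: le_trans IH; rewrite mulrC ler_wpM2r ?sqr_ge0//.
  rewrite mulrA ler_pdivrMr// -[m.+1%:R]natr1.
  have : 0 <= m%:R :> R by [].
  by move: m%:R => x x0; nra.
have : 0 <= m%:R * u m ^+ 2 by rewrite mulr_ge0// sqr_ge0.
have := sqr_ge0 (u m); lra.
Qed.

End Binomial.

(** * Poisson summation in dimension one *)

Section PolyaLimit.
Variables (R : realType) (t b s th : R) (m : nat -> nat) (p : nat -> int).
Variable L : nat -> R.
Hypotheses (LE : forall N, L N = N.*2.+1%:R) (t0 : 0 < t)
  (mL : (fun N => (m N)%:R / L N ^+ 2) @ \oo --> t / pi)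
  (pL : (fun N => (p N)%:~R / L N) @ \oo --> b).

(** The summands of [polya_identity] are normalised so as to converge termwise: the left one by
    [4 ^ m], the right one by the central binomial coefficient. *)
Definition polya_left N (l : int) : R :=
  cos (pi * (l%:~R + s) / L N) ^+ (m N).*2 *
  cos (2 * pi * (p N)%:~R * (l%:~R + s) / L N + th).

Definition polya_right N (k : int) : R :=
  'C((m N).*2, (m N + absz (N.*2.+1%:Z * k - p N)%R)%N)%:R /
  'C((m N).*2, m N)%:R * cos (2 * pi * k%:~R * s + th).

Definition gauss_left (l : int) : R :=
  expR (- (pi * t * (l%:~R + s) ^+ 2)) * cos (2 * pi * b * (l%:~R + s) + th).

Definition gauss_right (k : int) : R :=
  expR (- (pi * (k%:~R - b) ^+ 2 / t)) * cos (2 * pi * k%:~R * s + th).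

Let pi0 : 0 < pi :> R := @pi_gt0 R.

Let L0 N : 0 < L N. Proof. by rewrite LE ltr0n. Qed.

Let tpi0 : 0 < t / pi. Proof. exact: divr_gt0. Qed.

Lemma cvg_LV : (fun N => (L N)^-1) @ \oo --> (0 : R).
Proof.
apply: (@squeeze_cvgr _ _ _ _ (fun=> 0) harmonic).
- near=> N; rewrite invr_ge0 ltW//= /harmonic/= LE lef_pV2 ?posrE ?ltr0n//.
  by rewrite ler_nat ltnS -addnn leq_addl.
- exact: cvg_cst.
- exact: cvg_harmonic.
Unshelve. all: by end_near. Qed.

Lemma cvg_mV : (fun N => (m N)%:R^-1 : R) @ \oo --> (0 : R).
Proof.
have -> : (fun N => (m N)%:R^-1 : R) =
    (fun N => ((m N)%:R / L N ^+ 2)^-1 * ((L N)^-1 * (L N)^-1)).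
  apply/funext => N; have Ln0 : L N != 0 by rewrite gt_eqF.
  (* At [m = 0] both sides are 0, the inverse of 0 being 0. *)
  have [m0|mn0] := eqVneq ((m N)%:R : R) 0; first by rewrite m0 mul0r invr0 mul0r.
  by field; rewrite Ln0.
rewrite -[X in _ --> X](mulr0 (t / pi)^-1); apply: cvgM.
  by apply: cvgV => //; rewrite gt_eqF.
rewrite -[X in _ --> X](mulr0 0); apply: cvgM; exact: cvg_LV.
Qed.

Lemma near_m : \forall N \near \oo, t / pi / 2 <= (m N)%:R / L N ^+ 2.
Proof.
apply: (cvgr_ge _ mL); rewrite ltr_pdivrMr// ltr_pMr//; lra.
Qed.

Lemma near_m_gt0 : \forall N \near \oo, (0 < m N)%N.
Proof.
near=> N.
have : t / pi / 2 <= (m N)%:R / L N ^+ 2 by near: N; exact: near_m.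
move/(lt_le_trans (divr_gt0 tpi0 (ltr0n R 2))).
by rewrite pmulr_lgt0 ?ltr0n// invr_gt0 exprn_gt0.
Unshelve. all: by end_near. Qed.

Lemma cvg_m_oo : m @ \oo --> \oo.
Proof.
apply/cvgnyPge => A; near=> N.
have m0 : (0 < m N)%N by near: N; exact: near_m_gt0.
have : (m N)%:R^-1 < (A.+1%:R)^-1 :> R.
  by near: N; apply: (cvgr_lt _ cvg_mV); rewrite invr_gt0 ltr0n.
by rewrite ltf_pV2 ?posrE ?ltr0n// ltr_nat => /ltnW/ltnW.
Unshelve. all: by end_near. Qed.

(** With [y = pi (l + s) / L], the power of cosine is [(1 - sin y ^ 2) ^ m], and [m sin y ^ 2] has
    the same limit as [m y ^ 2], namely [pi t (l + s) ^ 2]. *)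
Lemma polya_left_cvg (l : int) : polya_left ^~ l @ \oo --> gauss_left l.
Proof.
apply: cvgM; last first.
  apply: continuous_cvg; first exact: continuous_cos.
  apply: cvgD; last exact: cvg_cst.
  rewrite (_ : (fun N => _) = fun N => 2 * pi * ((p N)%:~R / L N) * (l%:~R + s)).
    by apply: cvgM; [apply: cvgM => //; exact: cvg_cst|exact: cvg_cst].
  by apply/funext => N; field; rewrite gt_eqF.
pose x := l%:~R + s; pose y N := pi * x / L N.
have cy : y @ \oo --> (0 : R).
  rewrite -[X in _ --> X](mulr0 (pi * x)); apply: cvgM; [exact: cvg_cst|exact: cvg_LV].
have cys : (fun N => (m N)%:R * (y N) ^+ 2) @ \oo --> pi * t * x ^+ 2.
  rewrite (_ : (fun N => _) = fun N => (m N)%:R / L N ^+ 2 * (pi * x) ^+ 2).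
    rewrite (_ : pi * t * x ^+ 2 = t / pi * (pi * x) ^+ 2).
      by apply: cvgM => //; exact: cvg_cst.
    by move: (pi : R) pi0 => P P0; field; rewrite gt_eqF.
  by apply/funext => N; rewrite /y; field; rewrite gt_eqF.
have near_y : \forall N \near \oo, `|y N| <= pi / 2.
  have cn : (fun N => `|y N|) @ \oo --> (0 : R) by apply/norm_cvg0P.
  by apply: (cvgr_le _ cn); rewrite divr_gt0.
have csin : (fun N => (m N)%:R * sin (y N) ^+ 2) @ \oo --> pi * t * x ^+ 2.
  apply: (@squeeze_cvgr _ _ _ _ (fun N => (m N)%:R * (y N) ^+ 2 * cos (y N) ^+ 2)
    (fun N => (m N)%:R * (y N) ^+ 2)) => //.
    near=> N; have /sin_sqr_bounds/andP[h1 h2] : `|y N| <= pi / 2 by near: N.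
    by apply/andP; split; rewrite -?(mulrA _ (_ ^+ 2)); apply: ler_wpM2l.
  rewrite -[X in _ --> X]mulr1; apply: cvgM => //.
  rewrite -[X in _ --> X](expr1n _ 2) -(@cos0 R).
  have cc : (fun N => cos (y N)) @ \oo --> cos (0 : R).
    by apply: continuous_cvg => //; exact: continuous_cos.
  exact: cvgM.
rewrite (_ : (fun N => _) = fun N => (1 - sin (y N) ^+ 2) ^+ m N); last first.
  by apply/funext => N; rewrite -mul2n exprM cos2sin2.
apply: cvg_one_sub_pow => //; first by move=> N; exact: sqr_ge0.
have cs : (fun N => sin (y N)) @ \oo --> (0 : R).
  by rewrite -(@sin0 R); apply: continuous_cvg => //; exact: continuous_sin.
by rewrite -[X in _ --> X](mulr0 0); exact: cvgM.
Unshelve. all: by end_near. Qed.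

Lemma isum_polya_left :
  (fun N => isum N (polya_left N)) @ \oo --> zsum gauss_left.
Proof.
have [c c0 sinc] := sin_sqr_lower R.
(* Eventually [m / L ^ 2] is at least [t / (2 pi)]; with the angle [pi (l + s) / L] and the constant
   [c], this bounds [m sin ^ 2] below by [K (l + s) ^ 2]. *)
pose K := c * pi * t / 2.
have K0 : 0 < K by rewrite /K divr_gt0 ?mulr_gt0.
apply: (@isum_gauss_dominated _ (K / 2) (expR (K * s ^+ 2)) id) => //.
- by rewrite divr_gt0.
- near=> N => l lN.
  rewrite normrM (@le_trans _ _ (cos (pi * (l%:~R + s) / L N) ^+ (m N).*2))//.
    rewrite -mul2n exprM normrX (ger0_norm (sqr_ge0 _)).
    by apply: ler_piMr; [rewrite exprn_ge0 ?sqr_ge0|exact: cos_max].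
  rewrite /gauss -expRD -mul2n exprM cos2sin2.
  set y := pi * _ / _.
  apply: (@le_trans _ _ (expR (- ((m N)%:R * sin y ^+ 2)))).
    rewrite -[X in expR X]mulrN expRM_natl lerXn2r ?nnegrE ?expR_ge0//; last exact: expR_ge1Dx.
  rewrite ler_expR.
  (* Once [2 |s| <= N], [|l + s|] is at most [3 N / 2], hence below [3 L / 4]: the shift can take
     the angle past [pi / 2], but not past [3 pi / 4]. *)
  have y34 : `|y| <= 3 * pi / 4.
    rewrite /y !normrM (gtr0_norm pi0) normfV (gtr0_norm (L0 N)) ler_pdivrMr//.
    rewrite (_ : 3 * pi / 4 * L N = pi * (3 / 4 * L N)); last by field.
    rewrite ler_pM2l// (le_trans (ler_normD _ _))//.
    have h1 : `|l%:~R| <= N%:R :> R by rewrite -intr_norm -natr_absz ler_nat.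
    have h2 : 2 * `|s| <= N%:R by near: N; exact: nbhs_infty_ger.
    rewrite LE natr_doubleS; lra.
  have hm : t / pi / 2 <= (m N)%:R / L N ^+ 2 by near: N; exact: near_m.
  have hy : K * (l%:~R + s) ^+ 2 <= (m N)%:R * sin y ^+ 2.
    apply: le_trans (ler_wpM2l _ (sinc _ y34)); last by [].
    have -> : (m N)%:R * (c * y ^+ 2) =
       c * pi ^+ 2 * (l%:~R + s) ^+ 2 * ((m N)%:R / L N ^+ 2).
      by rewrite /y; field; rewrite gt_eqF.
    have -> : K * (l%:~R + s) ^+ 2 = c * pi ^+ 2 * (l%:~R + s) ^+ 2 * (t / pi / 2).
      by rewrite /K; move: (pi : R) pi0 => P P0; field; rewrite gt_eqF.
    apply: ler_wpM2l => //; apply: mulr_ge0; last exact: sqr_ge0.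
    by apply: mulr_ge0; [exact: ltW|exact: sqr_ge0].
  (* This square amounts to [K (l + s) ^ 2 >= K l ^ 2 / 2 - K s ^ 2], which frees the Gaussian from
     the shift. *)
  have : 0 <= K * (l%:~R + 2 * s) ^+ 2 by rewrite mulr_ge0 ?sqr_ge0// ltW.
  move: hy; lra.
- exact: polya_left_cvg.
Unshelve. all: by end_near. Qed.

Let q N (k : int) := absz (N.*2.+1%:Z * k - p N)%R.

Let qE N k : (q N k)%:R ^+ 2 = L N ^+ 2 * (k%:~R - (p N)%:~R / L N) ^+ 2 :> R.
Proof.
rewrite /q natr_absz intr_norm real_normK ?num_real// intrB intrM -pmulrn -LE.
by field; rewrite gt_eqF.
Qed.

Lemma polya_right_cvg (k : int) : polya_right ^~ k @ \oo --> gauss_right k.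
Proof.
apply: cvgM; last exact: cvg_cst.
apply: (@cvg_bin_ratio _ m (q ^~ k) _ cvg_mV near_m_gt0).
rewrite (_ : (fun N => _) = fun N => ((m N)%:R / L N ^+ 2)^-1 *
    ((k%:~R - (p N)%:~R / L N) * (k%:~R - (p N)%:~R / L N))); last first.
  by apply/funext => N; rewrite qE invf_div -expr2; ring.
rewrite (_ : _ / t = (t / pi)^-1 * ((k%:~R - b) * (k%:~R - b))); last first.
  by rewrite invf_div -expr2; ring.
apply: cvgM; first by apply: cvgV => //; rewrite gt_eqF.
by apply: cvgM; apply: cvgB => //; exact: cvg_cst.
Qed.

Lemma isum_polya_right :
  (fun N => isum (m N + absz (p N))%N (polya_right N)) @ \oo --> zsum gauss_right.
Proof.
(* Eventually [m <= 2 (t / pi) L ^ 2], so [L ^ 2 / (2 m)] is at least [K]. *)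
pose K := pi / (t * 4).
have K0 : 0 < K by rewrite divr_gt0// mulr_gt0.
apply: (@isum_gauss_dominated _ (K / 2) (expR (K * (`|b| + 1) ^+ 2))
   (fun N => m N + absz (p N))%N) => //.
- by rewrite divr_gt0.
- apply/cvgnyPge => A; near=> N; apply: leq_trans (leq_addr _ _).
  by near: N; move/cvgnyPge: cvg_m_oo; exact.
- near=> N => k _.
  have m0 : (0 < m N)%N by near: N; exact: near_m_gt0.
  have mR : 0 < (m N)%:R :> R by rewrite ltr0n.
  have C0 := central_bin_gt0 R (m N).
  rewrite normrM (@le_trans _ _ ('C((m N).*2, (m N + q N k)%N)%:R / 'C((m N).*2, m N)%:R))//.
    rewrite ger0_norm ?divr_ge0 ?ler0n//.
    by apply: ler_piMr; [rewrite divr_ge0 ?ler0n|exact: cos_max].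
  (* [bin_upper] with [D = 2 m] covers [q <= m]; beyond, the coefficient is 0. *)
  apply: (@le_trans _ _ (expR (- ((q N k)%:R ^+ 2 / ((m N).*2)%:R)))).
    rewrite ler_pdivrMr// mulrC; have [qm|mq] := leqP (q N k) (m N).
      by apply: bin_upper; lia.
    by rewrite bin_small ?mulr_ge0 ?expR_ge0 ?(ltW C0)//; lia.
  rewrite /gauss -expRD ler_expR qE -mul2n natrM.
  have xb : `|(p N)%:~R / L N| <= `|b| + 1.
    near: N; have cn : (fun N => `|(p N)%:~R / L N|) @ \oo --> `|b| by exact: cvg_norm.
    by apply: (cvgr_le _ cn); rewrite ltrDl.
  set x := (p N)%:~R / L N in xb *.
  have xb2 : x ^+ 2 <= (`|b| + 1) ^+ 2.
    by rewrite -[x ^+ 2]real_normK ?num_real// lerXn2r ?nnegrE// addr_ge0.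
  have hm : K <= L N ^+ 2 / (2 * (m N)%:R).
    have : (m N)%:R / L N ^+ 2 <= 2 * (t / pi).
      by near: N; apply: (cvgr_le _ mL); move: tpi0; lra.
    have mp : 0 < (m N)%:R / L N ^+ 2 by rewrite divr_gt0// exprn_gt0.
    have tp : 0 < 2 * (t / pi) by rewrite pmulr_rgt0.
    rewrite -lef_pV2 ?posrE// => h.
    rewrite (_ : K = (2 * (t / pi))^-1 / 2); last by rewrite /K; move: (pi : R) pi0 => P P0; field; rewrite !gt_eqF.
    rewrite (_ : L N ^+ 2 / _ = ((m N)%:R / L N ^+ 2)^-1 / 2); last by field; rewrite !gt_eqF.
    by rewrite ler_pM2r.
  have h1 : K * (k%:~R - x) ^+ 2 <= L N ^+ 2 * (k%:~R - x) ^+ 2 / (2 * (m N)%:R).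
    by rewrite [leRHS]mulrAC ler_wpM2r// sqr_ge0.
  have h2 : K * x ^+ 2 <= K * (`|b| + 1) ^+ 2 by rewrite ler_pM2l.
  have h3 : 0 <= K * (k%:~R - 2 * x) ^+ 2 by rewrite mulr_ge0 ?sqr_ge0// ltW.
  move: h1 h2 h3; set X := L N ^+ 2 * _ / _; lra.
- exact: polya_right_cvg.
Unshelve. all: by end_near. Qed.

(** The factor in front of the right-hand sum carries the constant of the Poisson formula. *)
Lemma polya_balance N :
  isum N (polya_left N) =
  L N * ('C((m N).*2, m N)%:R / 4 ^+ m N) * isum (m N + absz (p N))%N (polya_right N).
Proof.
have := @polya_identity R N (m N) _ (p N) s th (leqnn _); rewrite -!LE /=.
have -> : isum N (fun l => (2 * cos (pi * (l%:~R + s) / L N)) ^+ (m N).*2 *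
    cos (2 * pi * (p N)%:~R * (l%:~R + s) / L N + th)) =
  4 ^+ m N * isum N (polya_left N).
  rewrite -isumZ; apply: eq_isum => l; rewrite exprMn mulrA; congr (_ * _ * _).
  by rewrite -mul2n exprM expr2 -natrM.
have -> : isum (m N + absz (p N))%N
     (fun k => 'C((m N).*2, (m N + absz (N.*2.+1%:Z * k - p N)%R)%N)%:R *
               cos (2 * pi * k%:~R * s + th)) =
  'C((m N).*2, m N)%:R * isum (m N + absz (p N))%N (polya_right N).
  rewrite -isumZ; apply: eq_isum => k; rewrite /polya_right mulrA; congr (_ * _).
  by rewrite mulrCA divff ?mulr1// gt_eqF// central_bin_gt0.
have e0 : (4 : R) ^+ m N != 0 by rewrite expf_neq0.
move=> e; apply: (mulfI e0); rewrite e; field; exact: e0.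
Qed.

End PolyaLimit.

Section Poisson.
Variable R : realType.
Implicit Types (t b s th : R).
Let pi0 : 0 < pi :> R := @pi_gt0 R.

Lemma zsum_ge1 (F : int -> R) c C : 0 < c -> (forall k, `|F k| <= C * gauss c k) ->
  (forall k, 0 <= F k) -> F 0 = 1 -> 1 <= zsum F.
Proof.
move=> c0 Fc F0 F1; apply: (cvgr_to_ge (isum_gauss_cvg c0 Fc)).
by near=> N; rewrite -F1 isum_ge_term.
Unshelve. all: by end_near. Qed.

Lemma zsum_poisson t b s th : 0 < t ->
  zsum (gauss_left t b s th) = (Num.sqrt t)^-1 * zsum (gauss_right t b s th).
Proof.
pose L (N : nat) : R := N.*2.+1%:R.
have LE N : L N = N.*2.+1%:R by [].
have L0 N : 0 < L N by rewrite LE ltr0n.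
pose A := limn (fun m => m%:R * ('C(m.*2, m)%:R / 4 ^+ m) ^+ 2 : R).
have cA : (fun m => m%:R * ('C(m.*2, m)%:R / 4 ^+ m) ^+ 2 : R) @ \oo --> A.
  exact: central_bin_cvg.
have cLV : (fun N => (L N)^-1) @ \oo --> (0 : R) by exact: cvg_LV LE.
move: L LE L0 cLV => L LE L0 cLV.
(* The formula up to the unknown [A], for all parameters: one choice of them determines [A], the
   given ones conclude. *)
have key t' b' s' th' : 0 < t' ->
  zsum (gauss_left t' b' s' th') = Num.sqrt (pi / t' * A) * zsum (gauss_right t' b' s' th').
  move=> {b s th} t0.
  (* Rounding down [t' L ^ 2 / pi] and [b' L] gives the two limits, with errors at most [1 / L ^ 2]
     and [1 / L]. *)
  pose m N := Num.truncn (t' * L N ^+ 2 / pi); pose p N := Num.floor (b' * L N).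
  have mL : (fun N => (m N)%:R / L N ^+ 2) @ \oo --> t' / pi.
    apply: (@squeeze_cvgr _ _ _ _ (fun N => t' / pi - (L N)^-1 * (L N)^-1) (fun=> t' / pi)).
    - near=> N; have LN := L0 N.
      have /truncn_itv/andP[h1 h2] : 0 <= t' * L N ^+ 2 / pi.
        by rewrite divr_ge0 ?mulr_ge0 ?sqr_ge0// ltW.
      have L2 : 0 < L N ^+ 2 by rewrite exprn_gt0.
      rewrite ler_pdivlMr// ler_pdivrMr//.
      have e : t' * L N ^+ 2 / pi = t' / pi * L N ^+ 2 by rewrite mulrAC.
      rewrite -e -/(m N) in h1 h2 *; rewrite h1 andbT mulrBl -e.
      rewrite (_ : (L N)^-1 / L N * L N ^+ 2 = 1); last by field; rewrite gt_eqF.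
      by rewrite lerBlDr natr1 ltW.
    - rewrite -[X in _ --> X]subr0 -[X in _ - X](mulr0 0).
      by apply: cvgB; [exact: cvg_cst|exact: cvgM].
    - exact: cvg_cst.
  have pL : (fun N => (p N)%:~R / L N) @ \oo --> b'.
    apply: (@squeeze_cvgr _ _ _ _ (fun N => b' - (L N)^-1) (fun=> b')).
    - near=> N; have LN := L0 N.
      rewrite ler_pdivlMr// ler_pdivrMr// floor_le andbT mulrBl mulVf ?gt_eqF//.
      by rewrite lerBlDr ltW// -[X in _ + X]/(1%:~R) -intrD floorD1_gt.
    - by rewrite -[X in _ --> X]subr0; apply: cvgB => //; exact: cvg_cst.
    - exact: cvg_cst.
  have cl := isum_polya_left (s := s') (th := th') LE t0 mL pL.
  have cr := isum_polya_right (s := s') (th := th') LE t0 mL pL.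
  have moo := cvg_m_oo LE t0 mL.
  have cK : (fun N => L N * ('C((m N).*2, m N)%:R / 4 ^+ m N)) @ \oo --> Num.sqrt (pi / t' * A).
    rewrite (_ : (fun N => _) = Num.sqrt \o (fun N => (L N * ('C((m N).*2, m N)%:R / 4 ^+ m N)) ^+ 2)); last first.
      apply/funext => N /=; rewrite sqrtr_sqr ger0_norm//.
      by rewrite mulr_ge0 ?(ltW (L0 N))// divr_ge0 ?exprn_ge0.
    apply: continuous_cvg; first exact: sqrt_continuous.
    rewrite (_ : pi / t' * A = (t' / pi)^-1 * A); last by rewrite invf_div.
    have cv : (fun N => ((m N)%:R / L N ^+ 2)^-1 *
        ((m N)%:R * ('C((m N).*2, m N)%:R / 4 ^+ m N) ^+ 2)) @ \oo --> (t' / pi)^-1 * A.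
      apply: cvgM; first by apply: cvgV => //; rewrite gt_eqF// divr_gt0.
      exact: (cvg_comp _ _ moo cA).
    apply: cvg_trans cv; apply: near_eq_cvg; near=> N.
    have m0 : (0 < m N)%N by near: N; exact: near_m_gt0 LE t0 mL.
    rewrite invf_div; set X := _ / 4 ^+ _.
    by field; rewrite pnatr_eq0 -lt0n.
  have cl' : (fun N => isum N (polya_left s' th' m p L N)) @ \oo -->
      Num.sqrt (pi / t' * A) * zsum (gauss_right t' b' s' th').
    rewrite (_ : (fun N => _) = fun N => L N * ('C((m N).*2, m N)%:R / 4 ^+ m N)
      * isum (m N + absz (p N))%N (polya_right s' th' m p N)).
      exact: cvgM.
    by apply/funext => N; exact: polya_balance.
  by rewrite -(cvg_lim _ cl)// -(cvg_lim _ cl').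
(* At [t = 1] without shifts or phase, the two Gaussian sums are the same number, at least 1, so the
   constant is 1. *)
have A1 : pi * A = 1.
  have := key 1 0 0 0 ltr01.
  have -> : gauss_right 1 0 0 0 = gauss_left 1 0 0 0 :> (int -> R).
    apply/funext => k; rewrite /gauss_left /gauss_right !(mulr0, mul0r) !mulr1 divr1 subr0 !addr0.
    by [].
  set Z := zsum _.
  have Z1 : 1 <= Z.
    have gE : gauss_left 1 0 0 0 = gauss pi :> (int -> R).
      apply/funext => k; rewrite /gauss_left /gauss.
      by rewrite !(mulr0, mul0r) !addr0 mulr1 cos0 mulr1 mulNr.
    rewrite /Z gE; apply: (@zsum_ge1 _ pi 1) => // [k|k|]; rewrite /gauss.
    - by rewrite mul1r ger0_norm// expR_ge0.
    - exact: expR_ge0.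
    - by rewrite expr0n/= mulr0 expR0.
  move=> e; have {e} : Num.sqrt (pi / 1 * A) = 1.
    apply: (mulIf (_ : Z != 0)); last by rewrite mul1r.
    by rewrite gt_eqF// (lt_le_trans _ Z1).
  rewrite divr1 => e; rewrite -[RHS](expr1n _ 2) -e sqr_sqrtr//.
  (* A negative [pi * A] is excluded because its square root would be 0 by convention. *)
  rewrite leNgt; apply/negP => n; move: e; rewrite ler0_sqrtr ?ltW// => /esym/eqP.
  by rewrite oner_eq0.
move=> t0; rewrite key// mulrAC A1 mul1r sqrtrV//; exact: ltW.
Unshelve. all: by end_near. Qed.

End Poisson.

(** * Sums over Z^n *)

Section MultiSums.
Variable R : realType.
Implicit Types (n N : nat) (c C : R) (k : int).

(** Peeling off the first coordinate reduces to dimension one by induction; [bsum_box] identifies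
    the result with the box sums of the theta series. *)
Fixpoint bsum n N : ('rV[R]_n -> R) -> R :=
  match n with
  | 0 => fun F => F 0
  | n'.+1 => fun F => isum N (fun k => bsum N (fun u => F (row_mx k%:~R%:M u)))
  end.

(** An iterated limit, which for terms of Gaussian decay is also the limit over boxes
    ([nsum_cvg]). *)
Fixpoint nsum n : ('rV[R]_n -> R) -> R :=
  match n with
  | 0 => fun F => F 0
  | n'.+1 => fun F => zsum (fun k => nsum (fun u => F (row_mx k%:~R%:M u)))
  end.

Definition ngauss n c (u : 'rV[R]_n) : R := expR (- c * sqnorm u).

Lemma sqnorm_ge0 n (u : 'rV[R]_n) : 0 <= sqnorm u.
Proof. by rewrite /sqnorm sumr_ge0// => i _; rewrite sqr_ge0. Qed.

Lemma sqnorm_row_mx n (a : R) (u : 'rV[R]_n) :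
  sqnorm (row_mx a%:M u) = a ^+ 2 + sqnorm u.
Proof.
rewrite /sqnorm big_split_ord/= big_ord1 row_mxEl mxE eqxx mulr1n.
by congr (_ + _); apply: eq_bigr => i _; rewrite row_mxEr.
Qed.

Lemma ngauss_row_mx n c k (u : 'rV[R]_n) :
  ngauss c (row_mx k%:~R%:M u) = gauss c k * ngauss c u.
Proof. by rewrite /ngauss /gauss sqnorm_row_mx mulrDr expRD. Qed.

Lemma eq_bsum n N (F G : 'rV[R]_n -> R) : F =1 G -> bsum N F = bsum N G.
Proof. by move=> e; congr bsum; apply/funext. Qed.

Lemma eq_nsum n (F G : 'rV[R]_n -> R) : F =1 G -> nsum F = nsum G.
Proof. by move=> e; congr nsum; apply/funext. Qed.

Lemma bsumD n N (F G : 'rV[R]_n -> R) :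
  bsum N (fun u => F u + G u) = bsum N F + bsum N G.
Proof.
elim: n F G => [//|n IH] F G /=.
by rewrite -isumD; apply: eq_isum => k; rewrite IH.
Qed.

Lemma bsumZ n N (a : R) (F : 'rV[R]_n -> R) :
  bsum N (fun u => a * F u) = a * bsum N F.
Proof.
elim: n F => [//|n IH] F /=.
by rewrite -isumZ; apply: eq_isum => k; rewrite IH.
Qed.

Lemma ler_bsum n N (F G : 'rV[R]_n -> R) : (forall u, F u <= G u) ->
  bsum N F <= bsum N G.
Proof.
elim: n F G => [|n IH] F G FG /=; first exact: FG.
by apply: ler_isum => k _; apply: IH.
Qed.

Lemma ler_norm_bsum n N (F : 'rV[R]_n -> R) :
  `|bsum N F| <= bsum N (fun u => `|F u|).
Proof.
elim: n F => [//|n IH] F /=.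
by apply: le_trans (ler_norm_isum _ _) _; apply: ler_isum => k _; exact: IH.
Qed.

Lemma bsum_ge0 n N (F : 'rV[R]_n -> R) : (forall u, 0 <= F u) -> 0 <= bsum N F.
Proof.
elim: n F => [|n IH] F F0 /=; first exact: F0.
by apply: le_trans (isum_ge_term N _) => [|k]; apply: IH.
Qed.

Lemma bsum_ge_term n N (F : 'rV[R]_n -> R) : (forall u, 0 <= F u) ->
  F 0 <= bsum N F.
Proof.
elim: n F => [//|n IH] F F0 /=.
apply: le_trans (isum_ge_term N _) => [|k]; last exact: bsum_ge0.
apply: le_trans (IH _ (fun u => F0 _)).
rewrite (_ : row_mx _ _ = 0)//; apply/rowP => i; rewrite !mxE.
by case: splitP => j _; rewrite !mxE ?mul0rn.
Qed.

Lemma bsum_gauss_bounded n c : 0 < c ->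
  exists2 M, 0 <= M & forall N, bsum N (@ngauss n c) <= M.
Proof.
move=> c0; have [M1 HM1] := isum_gauss_bounded c0.
elim: n => [|n [M M0 IH]]; first by exists (ngauss c (0 : 'rV_0)) => //; exact: expR_ge0.
exists (M * M1) => [|N /=].
  rewrite mulr_ge0// (le_trans _ (HM1 0%N))//.
  by rewrite /isum big_ord0 addr0 expR_ge0.
rewrite (le_trans _ (ler_wpM2l M0 (HM1 N)))// -isumZ; apply: ler_isum => k _.
rewrite (eq_bsum _ (ngauss_row_mx c k)) bsumZ mulrC ler_wpM2r//.
exact: expR_ge0.
Qed.

Lemma isum_bsum_dominated n c C (F_ : nat -> int -> 'rV[R]_n -> R)
    (F : int -> 'rV[R]_n -> R) :
  0 < c -> (forall N k u, `|F_ N k u| <= C * (gauss c k * ngauss c u)) ->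
  (forall k, (fun N => bsum N (F_ N k)) @ \oo --> nsum (F k)) ->
  (fun N => isum N (fun k => bsum N (F_ N k))) @ \oo --> zsum (fun k => nsum (F k)).
Proof.
move=> c0 FC FF; have [M M0 HM] := bsum_gauss_bounded n c0.
have C0 : 0 <= C.
  have := le_trans (normr_ge0 _) (FC 0%N 0 0).
  by rewrite pmulr_lge0// mulr_gt0 ?expR_gt0.
apply: (isum_gauss_dominated (B := id) (C := C * M) c0) => //.
near=> N => k _; rewrite (le_trans (ler_norm_bsum _ _))//.
apply: (@le_trans _ _ (bsum N (fun u : 'rV[R]_n => C * gauss c k * ngauss c u))).
  by apply: ler_bsum => u; rewrite (le_trans (FC _ _ _))// mulrA.
rewrite bsumZ [leRHS]mulrAC; apply: ler_wpM2l => //.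
by rewrite mulr_ge0// expR_ge0.
Unshelve. all: by end_near. Qed.

(** The summand may change along with the box. Taken constant it gives [nsum_cvg]; taken as a
    truncated sum over another variable it gives [zsum_nsum]. *)
Lemma nsum_dominated n c C (F_ : nat -> 'rV[R]_n -> R) (F : 'rV[R]_n -> R) :
  0 < c -> (forall N u, `|F_ N u| <= C * ngauss c u) ->
  (forall u, F_ ^~ u @ \oo --> F u) ->
  (fun N => bsum N (F_ N)) @ \oo --> nsum F.
Proof.
move=> c0; elim: n C F_ F => [|n IH] C F_ F FC FF /=; first exact: FF.
have FC' N k (u : 'rV[R]_n) :
    `|F_ N (row_mx k%:~R%:M u)| <= C * (gauss c k * ngauss c u).
  by rewrite (le_trans (FC _ _))// ngauss_row_mx.
apply: (isum_bsum_dominated (F_ := fun N k u => F_ N (row_mx k%:~R%:M u)) c0 FC') => k.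
apply: (IH (C * gauss c k)) => [N u|u]; last exact: FF.
by rewrite -mulrA.
Qed.

Lemma nsum_cvg n c C (F : 'rV[R]_n -> R) : 0 < c ->
  (forall u, `|F u| <= C * ngauss c u) -> (fun N => bsum N F) @ \oo --> nsum F.
Proof.
move=> c0 FC; apply: (nsum_dominated c0 (C := C)) => // u; exact: cvg_cst.
Qed.

Lemma nsumZ n c C a (F : 'rV[R]_n -> R) : 0 < c ->
  (forall u, `|F u| <= C * ngauss c u) -> nsum (fun u => a * F u) = a * nsum F.
Proof.
move=> c0 FC.
have cF : (fun N => a * bsum N F) @ \oo --> a * nsum F.
  by apply: cvgM; [exact: cvg_cst|exact: (nsum_cvg c0 FC)].
have caF : (fun N => bsum N (fun u => a * F u)) @ \oo --> nsum (fun u => a * F u).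
  apply: (@nsum_cvg _ c (`|a| * C)) => // u.
  by rewrite normrM -mulrA ler_wpM2l.
have e : (fun N => bsum N (fun u => a * F u)) = (fun N => a * bsum N F).
  by apply/funext => N; rewrite bsumZ.
by rewrite -(cvg_lim _ cF)// -(cvg_lim _ caF)// e.
Qed.

Lemma nsumD n c C C' (F G : 'rV[R]_n -> R) : 0 < c ->
  (forall u, `|F u| <= C * ngauss c u) -> (forall u, `|G u| <= C' * ngauss c u) ->
  nsum (fun u => F u + G u) = nsum F + nsum G.
Proof.
move=> c0 FC GC.
have cFG : (fun N => bsum N F + bsum N G) @ \oo --> nsum F + nsum G.
  by apply: cvgD; [exact: nsum_cvg FC|exact: (nsum_cvg c0 GC)].
have cS : (fun N => bsum N (fun u => F u + G u)) @ \oo --> nsum (fun u => F u + G u).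
  apply: (@nsum_cvg _ c (C + C')) => // u.
  by rewrite (le_trans (ler_normD _ _))// mulrDl lerD.
have e : (fun N => bsum N (fun u => F u + G u)) = (fun N => bsum N F + bsum N G).
  by apply/funext => N; rewrite bsumD.
by rewrite -(cvg_lim _ cFG)// -(cvg_lim _ cS)// e.
Qed.

Lemma isum_exchange N (f : int -> int -> R) :
  isum N (fun k => isum N (f k)) = isum N (fun l => isum N (f ^~ l)).
Proof.
rewrite -!isum_ordE; under eq_bigr do rewrite -isum_ordE.
rewrite exchange_big; apply: eq_bigr => i _; exact: isum_ordE.
Qed.

Lemma bsum_isum n N (F : int -> 'rV[R]_n -> R) :
  bsum N (fun u => isum N (F ^~ u)) = isum N (fun k => bsum N (F k)).
Proof.
elim: n F => [//|n IH] F /=; rewrite isum_exchange.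
by apply: eq_isum => k; rewrite IH.
Qed.

(** Both sides are limits of the same finite sums, in which the order is free. *)
Lemma zsum_nsum n c C (F : int -> 'rV[R]_n -> R) : 0 < c ->
  (forall k u, `|F k u| <= C * (gauss c k * ngauss c u)) ->
  zsum (fun k => nsum (F k)) = nsum (fun u => zsum (F ^~ u)).
Proof.
move=> c0 FC.
have c1 : (fun N => isum N (fun k => bsum N (F k))) @ \oo --> zsum (fun k => nsum (F k)).
  apply: (isum_bsum_dominated (F_ := fun=> F) c0) => // k.
  by apply: (nsum_cvg c0 (C := C * gauss c k)) => u; rewrite -mulrA.
have C0 : 0 <= C.
  have := le_trans (normr_ge0 _) (FC 0 0).
  by rewrite pmulr_lge0// mulr_gt0 ?expR_gt0.
have [M HM] := isum_gauss_bounded c0.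
have c2 : (fun N => bsum N (fun u => isum N (F ^~ u))) @ \oo --> nsum (fun u => zsum (F ^~ u)).
  apply: (nsum_dominated c0 (C := C * M)) => [N u|u].
    rewrite (le_trans (ler_norm_isum _ _))//.
    apply: (@le_trans _ _ (isum N (fun k => C * ngauss c u * gauss c k))).
      by apply: ler_isum => k _; rewrite -mulrA (mulrC (ngauss _ _)).
    rewrite isumZ [leRHS]mulrAC; apply: ler_wpM2l => //.
    by rewrite mulr_ge0// expR_ge0.
  apply: (isum_gauss_cvg c0 (C := C * ngauss c u)) => k.
  by rewrite -mulrA (mulrC (ngauss _ _)).
have e : (fun N => bsum N (fun u => isum N (F ^~ u))) =
    (fun N => isum N (fun k => bsum N (F k))).
  by apply/funext => N; rewrite bsum_isum.
by rewrite -(cvg_lim _ c1)// -(cvg_lim _ c2)// e.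
Qed.

Lemma bsum_box n N (F : 'rV[R]_n -> R) :
  \sum_(f : {ffun 'I_n -> 'I_(N.*2.+1)}) F (box_vec R f) = bsum N F.
Proof.
elim: n F => [|n IH] F /=.
  rewrite (eq_bigr (fun=> F 0)) => [|f _]; last first.
    by congr F; apply/rowP => -[].
  by rewrite sumr_const card_ffun !card_ord expn0.
rewrite -isum_ordE; under [RHS]eq_bigr do rewrite -IH.
pose h (x : 'I_(N.*2.+1) * {ffun 'I_n -> 'I_(N.*2.+1)}) : {ffun 'I_n.+1 -> 'I_(N.*2.+1)} :=
  [ffun i => if unlift ord0 i is Some j then x.2 j else x.1].
pose h' (f : {ffun 'I_n.+1 -> 'I_(N.*2.+1)}) := (f ord0, [ffun j => f (lift ord0 j)]).
rewrite pair_big /= (reindex h); last first.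
  exists h' => [[a g] _|f _].
    rewrite /h' /h ffunE unlift_none; congr pair.
    by apply/ffunP => j; rewrite !ffunE liftK.
  apply/ffunP => i; rewrite /h ffunE /=.
  by case: unliftP => [j ->|->]; rewrite ?ffunE.
apply: eq_bigr => -[a g] _ /=; congr F; apply/rowP => i.
rewrite !mxE; case: splitP => j ij; rewrite !mxE.
  rewrite ffunE (_ : i = ord0); last by apply: val_inj; rewrite /= ij ord1.
  by rewrite unlift_none /= ord1 mulr1n intrB -!pmulrn.
rewrite ffunE (_ : i = lift ord0 j) ?liftK//.
by apply: val_inj; rewrite /= ij.
Qed.

End MultiSums.

(** * Lattice Gaussians and Poisson summation *)

Section LatticePoisson.
Variable R : realType.
Let pi0 : 0 < pi :> R := @pi_gt0 R.

Lemma zsumZ c C a (F : int -> R) : 0 < c ->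
  (forall k, `|F k| <= C * gauss c k) -> zsum (fun k => a * F k) = a * zsum F.
Proof.
move=> c0 FC.
have cF : (fun N => a * isum N F) @ \oo --> a * zsum F.
  by apply: cvgM; [exact: cvg_cst|exact: (isum_gauss_cvg c0 FC)].
have e : (fun N => isum N (fun k => a * F k)) = (fun N => a * isum N F).
  by apply/funext => N; rewrite isumZ.
by rewrite -(cvg_lim _ cF)// -e.
Qed.

Lemma eq_zsum (F G : int -> R) : F =1 G -> zsum F = zsum G.
Proof. by move=> e; congr zsum; apply/funext. Qed.

Definition dot n (u v : 'rV[R]_n) : R := (u *m v^T) ord0 ord0.

Lemma dotC n (u v : 'rV[R]_n) : dot u v = dot v u.
Proof. by rewrite /dot -[u *m _]trmxK trmx_mul trmxK [LHS]mxE. Qed.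

Lemma dotDr n (u v w : 'rV[R]_n) : dot u (v + w) = dot u v + dot u w.
Proof. by rewrite /dot linearD/= mulmxDr mxE. Qed.

Lemma dotZr n a (u v : 'rV[R]_n) : dot u (a *: v) = a * dot u v.
Proof. by rewrite /dot linearZ/= -scalemxAr mxE. Qed.

Lemma dotNr n (u v : 'rV[R]_n) : dot u (- v) = - dot u v.
Proof. by rewrite -scaleN1r dotZr mulN1r. Qed.

Lemma dot_row_mx n (a : R) (u : 'rV[R]_n) (v : 'rV[R]_(1 + n)) :
  dot (row_mx a%:M u) v = a * v ord0 ord0 + dot u (rsubmx v).
Proof.
rewrite /dot -{1}[v]hsubmxK tr_row_mx mul_row_col mxE; congr (_ + _).
rewrite mul_scalar_mx !mxE; congr (_ * v _ _); exact: val_inj.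
Qed.

Lemma sqnorm_dot n (u : 'rV[R]_n) : sqnorm u = dot u u.
Proof. by rewrite /sqnorm /dot mxE; apply: eq_bigr => i _; rewrite mxE expr2. Qed.

Lemma mulmx_tr_scalar n (u v : 'rV[R]_n) : u *m v^T = (dot u v)%:M.
Proof. exact: mx11_scalar. Qed.

Lemma sqnorm_eq0 n (u : 'rV[R]_n) : (sqnorm u == 0) = (u == 0).
Proof.
apply/eqP/eqP => [|->]; last first.
  by rewrite /sqnorm big1// => i _; rewrite mxE expr0n.
move=> /eqP; rewrite /sqnorm psumr_eq0 => [/allP h|i _]; last exact: sqr_ge0.
apply/rowP => i; rewrite mxE; apply/eqP; rewrite -sqrf_eq0.
exact: (h i (mem_index_enum i)).
Qed.

Lemma sqnorm_mulmx_orthogonal n (Q : 'M[R]_n) (u : 'rV[R]_n) :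
  Q *m Q^T = 1%:M -> sqnorm (u *m Q) = sqnorm u.
Proof. by move=> QQ; rewrite !sqnorm_dot /dot trmx_mul mulmxA -(mulmxA u) QQ mulmx1. Qed.

(* The reflection exchanging [g] and its norm times the first basis vector. *)
Lemma householder n (g : 'rV[R]_(1 + n)) : exists2 Q : 'M[R]_(1 + n),
  Q *m Q^T = 1%:M & g *m Q = row_mx (Num.sqrt (sqnorm g))%:M 0.
Proof.
set r := Num.sqrt (sqnorm g); set e := row_mx 1%:M 0 : 'rV[R]_(1 + n).
have r2 : r ^+ 2 = sqnorm g by rewrite sqr_sqrtr// sqnorm_ge0.
have [v vE] : exists v, v = g - r *: e by exists (g - r *: e).
have re : r *: e = row_mx r%:M 0 by rewrite scale_row_mx scaler0 scale_scalar_mx mulr1.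
have [v0|vn0] := eqVneq v 0.
  exists 1%:M; first by rewrite trmx1 mulmx1.
  by rewrite mulmx1 -re; apply/eqP; rewrite -subr_eq0 -vE v0.
have s0 : sqnorm v != 0 by rewrite sqnorm_eq0.
pose Q : 'M[R]_(1 + n) := 1%:M - (2 / sqnorm v) *: (v^T *m v).
have QT : Q^T = Q by rewrite /Q linearB/= linearZ/= trmx1 trmx_mul trmxK.
exists Q.
  rewrite QT /Q; set Y := _ *: _.
  have YY : Y *m Y = Y + Y.
    rewrite /Y -scalemxAl -scalemxAr mulmxA -(mulmxA _ v) mulmx_tr_scalar -sqnorm_dot.
    rewrite mul_mx_scalar -scalemxAl !scalerA -scalerDl; congr (_ *: _).
    by field.
  by rewrite mulmxBl mul1mx mulmxBr mulmx1 YY opprB addrK subrK.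
rewrite /Q mulmxBr mulmx1 -scalemxAr mulmxA mulmx_tr_scalar mul_scalar_mx scalerA.
have ee : dot e e = 1.
  rewrite -sqnorm_dot sqnorm_row_mx expr1n (_ : sqnorm 0 = 0) ?addr0//.
  by apply/eqP; rewrite sqnorm_eq0.
have sv : sqnorm v = 2 * dot g v.
  rewrite sqnorm_dot {1}vE dotC dotDr dotNr dotZr (dotC v g) (dotC v e) vE.
  rewrite !dotDr !dotNr !dotZr ee -sqnorm_dot -r2 (dotC e g); ring.
rewrite sv mulrC; move: s0; rewrite sv => s0.
rewrite (_ : dot g v * _ = 1); last by field; move: s0; rewrite mulf_eq0 negb_or => /andP[].
by rewrite scale1r vE opprB addrCA subrr addr0 re.
Qed.

(** The reflection sends the first row of [G] to a multiple of the first basis vector. That multiple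
    is a norm, nonzero because the determinant is. *)
Lemma orthogonal_reduction n (G : 'M[R]_(1 + n)) : G \in unitmx ->
  exists Q t c (G' : 'M[R]_n), [/\ Q *m Q^T = 1%:M, 0 < t, G' \in unitmx &
    G *m Q = block_mx t%:M 0 c G'].
Proof.
move=> Gu; have [Q QQ gQ] := householder (usubmx G).
set t := Num.sqrt _ in gQ.
have HE : G *m Q = block_mx t%:M 0 (dlsubmx (G *m Q)) (drsubmx (G *m Q)).
  rewrite -[LHS]submxK; congr (block_mx _ _ _ _).
    by rewrite /ulsubmx -mul_usub_mx gQ row_mxKl.
  by rewrite /ursubmx -mul_usub_mx gQ row_mxKr.
have Qu : Q \in unitmx by case/mulmx1_unit: QQ.
have : G *m Q \in unitmx by rewrite unitmx_mul Gu.
rewrite {1}HE unitmxE det_lblock det_scalar1 unitrM unitfE => /andP[tn0 G'u].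
exists Q, t, (dlsubmx (G *m Q)), (drsubmx (G *m Q)); split => //.
by rewrite lt_neqAle eq_sym tn0 sqrtr_ge0.
Qed.

Lemma invmx_right n (A B : 'M[R]_n) : A *m B = 1%:M -> invmx A = B.
Proof. by move=> AB; have [Au _] := mulmx1_unit AB; rewrite -[LHS]mulmx1 -AB mulKmx. Qed.

Lemma invmx_lblock n (t : R) (c : 'cV[R]_n) (G' : 'M[R]_n) :
  t != 0 -> G' \in unitmx ->
  invmx (block_mx t%:M 0 c G') =
  block_mx t^-1%:M 0 (- (t^-1 *: (invmx G' *m c))) (invmx G').
Proof.
move=> t0 Gu.
apply: invmx_right.
rewrite mulmx_block !mul0mx !mulmx0 !addr0 !add0r -scalar_mxM divff// mulmxV//.
rewrite mul_mx_scalar mulmxN -scalemxAr mulmxA mulmxV// mul1mx subrr.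
by rewrite -scalar_mx_block.
Qed.

Lemma sqnorm_lblock n (t a : R) (c : 'cV[R]_n) (G' : 'M[R]_n) (u : 'rV[R]_n) :
  sqnorm (row_mx a%:M u *m block_mx t%:M 0 c G') =
  (a * t + dot u c^T) ^+ 2 + sqnorm (u *m G').
Proof.
rewrite mul_row_block mulmx0 add0r -scalar_mxM -[c in LHS]trmxK mulmx_tr_scalar.
by rewrite -raddfD/= sqnorm_row_mx.
Qed.

(** The right-hand side is arranged so that the shift left for [G'] is the phase found in
    [nsum_phase_lblock]. *)
Lemma sqnorm_dual_lblock n (t a : R) (c : 'cV[R]_n) (G' : 'M[R]_n)
    (w : 'rV[R]_n) (b : 'rV[R]_(1 + n)) : t != 0 -> G' \in unitmx ->
  sqnorm ((row_mx a%:M w - b) *m (invmx (block_mx t%:M 0 c G'))^T) =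
  ((a - b ord0 ord0) / t) ^+ 2 +
  sqnorm ((w - (rsubmx b + ((a - b ord0 ord0) / t) *: c^T)) *m (invmx G')^T).
Proof.
move=> t0 Gu; rewrite invmx_lblock// tr_block_mx tr_scalar_mx.
have -> : row_mx a%:M w - b = row_mx (a - b ord0 ord0)%:M (w - rsubmx b).
  rewrite -{1}[b]hsubmxK opp_row_mx add_row_mx; congr row_mx.
  by rewrite [lsubmx b]mx11_scalar -raddfB/= !mxE; congr (_ - b _ _)%:M; exact: val_inj.
rewrite mul_row_block trmx0 mulmx0 addr0 -scalar_mxM sqnorm_row_mx; congr (_ + sqnorm _).
rewrite mul_scalar_mx linearN/= linearZ/= trmx_mul scalerN scalerA.
by rewrite opprD addrA [in RHS]mulmxBl scalemxAl [LHS]addrC.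
Qed.

Lemma sqnorm_mulmx_le n (M : 'M[R]_n) :
  exists2 K, 0 < K & forall u, sqnorm (u *m M) <= K * sqnorm u.
Proof.
exists (1 + \sum_j (\sum_i `|M i j|) ^+ 2) => [|u].
  by rewrite ltr_pwDl// sumr_ge0// => j _; rewrite sqr_ge0.
rewrite mulrDl mul1r big_distrl/= -[leLHS]add0r lerD ?sqnorm_ge0//.
apply: ler_sum => j _.
have S0 := sqnorm_ge0 u.
have ui i : `|u ord0 i| <= Num.sqrt (sqnorm u).
  rewrite -sqrtr_sqr ler_wsqrtr// /sqnorm (bigD1 i)//= lerDl.
  by rewrite sumr_ge0// => k _; rewrite sqr_ge0.
rewrite -[X in _ * X]sqr_sqrtr// -exprMn -[leLHS]real_normK ?num_real//.
rewrite lerXn2r ?nnegrE// ?mulr_ge0 ?sqrtr_ge0 ?sumr_ge0//.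
rewrite mxE (le_trans (ler_norm_sum _ _ _))// mulr_suml; apply: ler_sum => i _.
by rewrite normrM mulrC ler_wpM2l.
Qed.

Lemma sqnorm_mulmx_ge n (G : 'M[R]_n) : G \in unitmx ->
  exists2 c, 0 < c & forall u, c * sqnorm u <= sqnorm (u *m G).
Proof.
move=> Gu; have [K K0 HK] := sqnorm_mulmx_le (invmx G).
exists K^-1 => [|u]; first by rewrite invr_gt0.
by rewrite mulrC ler_pdivrMr// mulrC -[X in sqnorm X <= _](mulmxK Gu).
Qed.

Lemma sqnorm_sub_ge n (u b : 'rV[R]_n) : sqnorm u / 2 - sqnorm b <= sqnorm (u - b).
Proof.
rewrite /sqnorm mulr_suml -sumrB; apply: ler_sum => i _; rewrite !mxE.
by have := sqr_ge0 (u ord0 i - 2 * b ord0 i); lra.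
Qed.

(** The shift is absorbed by [|u - b| ^ 2 >= |u| ^ 2 / 2 - |b| ^ 2], at the cost of half the
    rate. *)
Lemma lattice_gauss_dom n (G : 'M[R]_n) (b : 'rV[R]_n) : G \in unitmx ->
  exists c C, 0 < c /\ forall u,
    expR (- (pi * sqnorm ((u - b) *m G))) <= C * ngauss c u.
Proof.
move=> Gu; have [c c0 Hc] := sqnorm_mulmx_ge Gu.
exists (pi * c / 2), (expR (pi * c * sqnorm b)); split => [|u].
  by rewrite divr_gt0 ?mulr_gt0.
rewrite /ngauss -expRD ler_expR.
have pc0 : 0 < pi * c by rewrite mulr_gt0.
have := sqnorm_sub_ge u b; rewrite -(ler_pM2l pc0).
have : pi * (c * sqnorm (u - b)) <= pi * sqnorm ((u - b) *m G) by rewrite ler_pM2l.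
lra.
Qed.

End LatticePoisson.

(** * Poisson summation by induction on the dimension *)

Section PoissonSummation.
Variable R : realType.
Let pi0 : 0 < pi :> R := @pi_gt0 R.

(** A general [b] serves the induction: transforming the first variable creates a phase in the
    others. *)
Definition phase_theta n (G : 'M[R]_n) (b u : 'rV[R]_n) : R :=
  expR (- (pi * sqnorm (u *m G))) * cos (2 * pi * dot u b).

Definition shift_theta n (G : 'M[R]_n) (b w : 'rV[R]_n) : R :=
  expR (- (pi * sqnorm ((w - b) *m G))).

Lemma norm_mul_cos_le (x y z : R) : 0 <= x -> x <= z -> `|x * cos y| <= z.
Proof.
move=> x0; apply: le_trans; rewrite normrM (ger0_norm x0).
by apply: ler_piMr => //; exact: cos_max.
Qed.

Lemma phase_theta_dom n (G : 'M[R]_n) : G \in unitmx -> exists c C,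
  0 < c /\ forall b u, `|phase_theta G b u| <= C * ngauss c u.
Proof.
move=> /(lattice_gauss_dom 0)[c [C [c0 HC]]]; exists c, C; split => // b u.
apply: norm_mul_cos_le; first exact: expR_ge0.
by have := HC u; rewrite subr0.
Qed.

(** For fixed [u], the dependence on the first coordinate [k] is that of [gauss_left] at [t ^ 2].
    The sums are exchanged to apply [zsum_poisson] in [k], then exchanged back. *)
Lemma nsum_phase_lblock n (t : R) (c : 'cV[R]_n) (G' : 'M[R]_n)
    (b : 'rV[R]_(1 + n)) : 0 < t -> G' \in unitmx ->
  nsum (phase_theta (block_mx t%:M 0 c G') b) =
  t^-1 * zsum (fun k => expR (- (pi * ((k%:~R - b ord0 ord0) / t) ^+ 2)) *
    nsum (phase_theta G' (rsubmx b + ((k%:~R - b ord0 ord0) / t) *: c^T))).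
Proof.
move=> t0 Gu; have tn0 : t != 0 by rewrite gt_eqF.
set H := block_mx _ _ _ _; set b0 := b ord0 ord0.
have Hu : H \in unitmx.
  by rewrite unitmxE det_lblock det_scalar1 unitrM unitfE tn0 -unitmxE.
have [cH [CH [cH0 HH]]] := phase_theta_dom Hu.
have [c1 [C1 [c10 HG]]] := phase_theta_dom Gu.
pose E (u : 'rV[R]_n) := expR (- (pi * sqnorm (u *m G'))).
have EC u : E u <= C1 * ngauss c1 u.
  by have := HG 0 u; rewrite /phase_theta /dot trmx0 mulmx0 mxE mulr0 cos0 mulr1 ger0_norm ?expR_ge0.
have C10 : 0 <= C1.
  have := le_trans (expR_ge0 _) (EC 0); by rewrite pmulr_lge0// expR_gt0.
(* The first coordinate of the lattice vector is [t (k + s u)], and [th u] is chosen so that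
   [2 pi b0 (k + s u) + th u] is the original phase. *)
pose s (u : 'rV[R]_n) := dot u c^T / t.
pose th u := 2 * pi * dot u (rsubmx b) - 2 * pi * b0 * s u.
rewrite [LHS]/=.
rewrite (@zsum_nsum _ _ cH CH)//; last first.
  by move=> k u; rewrite -ngauss_row_mx; exact: HH.
have gr_le k u : `|gauss_right (t ^+ 2) b0 (s u) (th u) k| <=
    expR (pi / t ^+ 2 * b0 ^+ 2) * gauss (pi / t ^+ 2 / 2) k.
  apply: norm_mul_cos_le; first exact: expR_ge0.
  rewrite /gauss -expRD ler_expR.
  have p0 : 0 <= pi / t ^+ 2 by rewrite divr_ge0 ?sqr_ge0// ltW.
  have := mulr_ge0 p0 (sqr_ge0 (k%:~R - 2 * b0)).
  rewrite (mulrAC pi (_ ^+ 2) (t ^- 2)); set P := pi / t ^+ 2; lra.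
have ct0 : 0 < pi / t ^+ 2 / 2 by rewrite !divr_gt0 ?exprn_gt0.
have gl_le k u : `|gauss_left (t ^+ 2) b0 (s u) (th u) k| <=
    expR (pi * t ^+ 2 * s u ^+ 2) * gauss (pi * t ^+ 2 / 2) k.
  apply: norm_mul_cos_le; first exact: expR_ge0.
  rewrite /gauss -expRD ler_expR.
  have p0 : 0 <= pi * t ^+ 2 by rewrite mulr_ge0 ?sqr_ge0// ltW.
  have := mulr_ge0 p0 (sqr_ge0 (k%:~R + 2 * s u)).
  set P := pi * t ^+ 2; lra.
have inner u : zsum (fun k => phase_theta H b (row_mx k%:~R%:M u)) =
    t^-1 * zsum (fun k => E u * gauss_right (t ^+ 2) b0 (s u) (th u) k).
  rewrite (zsumZ _ ct0 (gr_le ^~ u)) mulrCA -[t in t^-1](gtr0_norm t0) -sqrtr_sqr.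
  rewrite -zsum_poisson ?exprn_gt0//.
  rewrite -(zsumZ _ _ (gl_le ^~ u)); last by rewrite divr_gt0// mulr_gt0// exprn_gt0.
  apply: eq_zsum => k; rewrite /phase_theta /gauss_left mulrA -expRD sqnorm_lblock dot_row_mx.
  congr (expR _ * cos _); last by rewrite -/b0 /th; ring.
  rewrite /s; move: (pi : R) => P; field; exact: tn0.
rewrite (eq_nsum inner).
set C2 := expR (pi / t ^+ 2 * b0 ^+ 2); set c2 := pi / t ^+ 2 / 2.
pose cc := Order.min c1 c2.
have cc0 : 0 < cc by rewrite lt_min c10.
have ngm u : ngauss c1 u <= @ngauss _ n cc u.
  by rewrite ler_expR ler_wpM2r ?sqnorm_ge0// lerN2 ge_min lexx.
have gm k : gauss c2 k <= gauss cc k.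
  by rewrite ler_expR ler_wpM2r ?sqr_ge0// lerN2 ge_min lexx orbT.
have F_le k u : `|E u * gauss_right (t ^+ 2) b0 (s u) (th u) k| <=
    C1 * C2 * (gauss cc k * ngauss cc u).
  rewrite normrM (ger0_norm (expR_ge0 _)).
  rewrite (le_trans (ler_pM (expR_ge0 _) (normr_ge0 _) (EC u) (gr_le k u)))//.
  rewrite mulrACA (mulrC (gauss _ _)) ler_wpM2l ?mulr_ge0 ?expR_ge0//.
  by apply: ler_pM; rewrite ?expR_ge0.
have [M HM] := isum_gauss_bounded cc0.
have Z_le u : `|zsum (fun k => E u * gauss_right (t ^+ 2) b0 (s u) (th u) k)| <=
    C1 * C2 * M * ngauss cc u.
  have FC k : `|E u * gauss_right (t ^+ 2) b0 (s u) (th u) k| <=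
      C1 * C2 * ngauss cc u * gauss cc k by rewrite -mulrA (mulrC (ngauss _ _)).
  have cn : (fun N => `|isum N (fun k => E u * gauss_right (t ^+ 2) b0 (s u) (th u) k)|) @ \oo -->
      `|zsum (fun k => E u * gauss_right (t ^+ 2) b0 (s u) (th u) k)|.
    by apply: cvg_norm; exact: isum_gauss_cvg cc0 FC.
  apply: (cvgr_to_le cn); near=> N.
  rewrite (le_trans (ler_norm_isum _ _))// (le_trans (ler_isum (fun k _ => FC k)))//.
  rewrite isumZ [leRHS]mulrAC ler_wpM2l// !mulr_ge0 ?expR_ge0//.
rewrite (nsumZ _ cc0 Z_le); congr (_ * _).
rewrite -(zsum_nsum cc0 F_le); apply: eq_zsum => k.
rewrite -(nsumZ _ c10 (HG _)); apply: eq_nsum => u.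
rewrite /E /gauss_right /phase_theta [LHS]mulrA [RHS]mulrA -!expRD.
congr (expR _ * cos _).
  by rewrite expr_div_n; ring.
(* The phase [2 pi k s + th] regroups as a pairing of [u] with the new shift. *)
rewrite dotDr dotZr /th /s -/b0; ring.
Unshelve. all: by end_near. Qed.

Lemma phase_theta_mul_orthogonal n (G Q : 'M[R]_n) b : Q *m Q^T = 1%:M ->
  phase_theta (G *m Q) b =1 phase_theta G b.
Proof. by move=> QQ u; rewrite /phase_theta mulmxA sqnorm_mulmx_orthogonal. Qed.

Lemma dual_gen_mul_orthogonal n (G Q : 'M[R]_n) : G \in unitmx ->
  Q *m Q^T = 1%:M -> dual_gen (G *m Q) = dual_gen G *m Q.
Proof.
move=> Gu QQ; rewrite /dual_gen (@invmx_right _ _ _ (Q^T *m invmx G)) ?trmx_mul ?trmxK//.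
by rewrite mulmxA -(mulmxA G) QQ mulmx1 mulmxV.
Qed.

Lemma norm_det_orthogonal n (Q : 'M[R]_n) : Q *m Q^T = 1%:M -> `|\det Q| = 1.
Proof.
move=> /(congr1 determinant); rewrite det_mulmx det_tr det1 -expr2 => /eqP.
by rewrite sqrf_eq1 => /orP[]/eqP->; rewrite ?normrN normr1.
Qed.

(** An orthogonal factor changes neither the norms, in the lattice or its dual, nor the absolute
    determinant, so [G] may be taken block triangular. The induction hypothesis then treats the
    inner sum for each [k]. *)
Lemma lattice_poisson_step n :
  (forall (G : 'M[R]_n) b, G \in unitmx ->
    nsum (phase_theta G b) = `|\det G|^-1 * nsum (shift_theta (dual_gen G) b)) ->
  forall (G : 'M[R]_(1 + n)) b, G \in unitmx ->
    nsum (phase_theta G b) = `|\det G|^-1 * nsum (shift_theta (dual_gen G) b).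
Proof.
move=> IH G b Gu.
have [Q [t [c [G' [QQ t0 G'u GQ]]]]] := orthogonal_reduction Gu.
have tn0 : t != 0 by rewrite gt_eqF.
rewrite -(eq_nsum (phase_theta_mul_orthogonal G b QQ)).
have -> : shift_theta (dual_gen G) b = shift_theta (dual_gen (G *m Q)) b.
  apply/funext => w; rewrite /shift_theta dual_gen_mul_orthogonal//.
  by rewrite mulmxA (sqnorm_mulmx_orthogonal _ QQ).
have -> : `|\det G| = t * `|\det G'|.
  rewrite -[LHS]mulr1 -(norm_det_orthogonal QQ) -normrM -det_mulmx GQ det_lblock.
  by rewrite det_scalar1 normrM gtr0_norm.
rewrite GQ nsum_phase_lblock// invfM -mulrA; congr (_ * _).
have G'd : dual_gen G' \in unitmx by rewrite /dual_gen unitmx_tr unitmx_inv.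
have Hd : dual_gen (block_mx t%:M 0 c G') \in unitmx.
  by rewrite /dual_gen unitmx_tr unitmx_inv unitmxE det_lblock det_scalar1 unitrM unitfE tn0 -unitmxE.
have [cH [CH [cH0 HH]]] := lattice_gauss_dom b Hd.
rewrite [RHS]/=.
have st k (w : 'rV[R]_n) : shift_theta (dual_gen (block_mx t%:M 0 c G')) b (row_mx k%:~R%:M w) =
   expR (- (pi * ((k%:~R - b ord0 ord0) / t) ^+ 2)) *
   shift_theta (dual_gen G') (rsubmx b + ((k%:~R - b ord0 ord0) / t) *: c^T) w.
  rewrite /shift_theta -expRD; congr expR.
  by rewrite [in LHS]/dual_gen (@sqnorm_dual_lblock _ n t _ c G' w b tn0 G'u) -/(dual_gen _); ring.
have [M M0 HM] := bsum_gauss_bounded n cH0.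
have cn k : (fun N => bsum N (fun w : 'rV[R]_n =>
      shift_theta (dual_gen (block_mx t%:M 0 c G')) b (row_mx k%:~R%:M w))) @ \oo -->
   nsum (fun w : 'rV[R]_n =>
      shift_theta (dual_gen (block_mx t%:M 0 c G')) b (row_mx k%:~R%:M w)).
  apply: (nsum_cvg cH0 (C := CH * gauss cH k)) => w.
  by rewrite ger0_norm ?expR_ge0// (le_trans (HH _))// ngauss_row_mx mulrA.
have CH0 : 0 <= CH.
  have := le_trans (expR_ge0 _) (HH 0); by rewrite pmulr_lge0// expR_gt0.
have Z_le k : `|nsum (fun w : 'rV[R]_n =>
      shift_theta (dual_gen (block_mx t%:M 0 c G')) b (row_mx k%:~R%:M w))| <= CH * M * gauss cH k.
  apply: (cvgr_to_le (cvg_norm (cn k))); near=> N.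
  rewrite (le_trans (ler_norm_bsum _ _))//.
  apply: (@le_trans _ _ (bsum N (fun w : 'rV[R]_n => CH * gauss cH k * ngauss cH w))).
    apply: ler_bsum => w; rewrite ger0_norm ?expR_ge0// (le_trans (HH _))//.
    by rewrite ngauss_row_mx mulrA.
  by rewrite bsumZ [leRHS]mulrAC ler_wpM2l// mulr_ge0 ?expR_ge0.
rewrite -(zsumZ _ cH0 Z_le); apply: eq_zsum => k.
rewrite (IH _ _ G'u) mulrCA; congr (_ * _).
rewrite (eq_nsum (st k)).
have [c3 [C3 [c30 H3]]] := lattice_gauss_dom
  (rsubmx b + ((k%:~R - b ord0 ord0) / t) *: c^T) G'd.
rewrite (@nsumZ _ _ c3 C3)// => w.
by rewrite ger0_norm ?expR_ge0 //; exact: H3.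
Unshelve. all: by end_near. Qed.

Theorem lattice_poisson n (G : 'M[R]_n) (b : 'rV[R]_n) : G \in unitmx ->
  nsum (phase_theta G b) = `|\det G|^-1 * nsum (shift_theta (dual_gen G) b).
Proof.
elim: n G b => [|n IH] G b Gu.
  rewrite /= /phase_theta /shift_theta det_mx00 normr1 invr1 mul1r.
  have s0 (v : 'rV[R]_0) : sqnorm v = 0 by rewrite /sqnorm big_ord0.
  by rewrite !s0 /dot mul0mx mxE [2 * pi * 0]mulr0 cos0 mulr1.
exact: lattice_poisson_step.
Qed.

End PoissonSummation.

(** * From the imaginary axis to the half-plane *)

Section DominatedSeries.
Variable R : realType.

(** Cut-offs [B N] chosen to leave an error of at most [1 / (N + 1)] reduce this to truncated
    sums. *)
Lemma zsum_dominated c C (F_ : nat -> int -> R) (F : int -> R) : 0 < c ->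
  (forall N k, `|F_ N k| <= C * gauss c k) -> (forall k, F_ ^~ k @ \oo --> F k) ->
  (fun N => zsum (F_ N)) @ \oo --> zsum F.
Proof.
move=> c0 FC FF.
have /choice[B HB] N : exists b, (N <= b)%N /\ `|zsum (F_ N) - isum b (F_ N)| <= harmonic N.
  have /cvgrPdist_le/(_ _ (harmonic_gt0 N))[K _ HK] := isum_gauss_cvg c0 (FC N).
  by exists (maxn N K); split; [exact: leq_maxl|apply: HK; exact: leq_maxr].
have Boo : B @ \oo --> \oo.
  apply/cvgnyPge => A; near=> N; apply: leq_trans (proj1 (HB N)).
  by near: N; exact: nbhs_infty_ge.
have c1 : (fun N => isum (B N) (F_ N)) @ \oo --> zsum F.
  by apply: (isum_gauss_dominated (C := C) c0 Boo) => //; near=> N => k _.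
have c2 : (fun N => zsum (F_ N) - isum (B N) (F_ N)) @ \oo --> (0 : R).
  apply/norm_cvg0P; apply: (@squeeze_cvgr _ _ _ _ (fun=> 0) harmonic).
  - by near=> N; rewrite normr_ge0 (proj2 (HB N)).
  - exact: cvg_cst.
  - exact: cvg_harmonic.
rewrite (_ : (fun N => _) = fun N => isum (B N) (F_ N) + (zsum (F_ N) - isum (B N) (F_ N))).
  by rewrite -[zsum F]addr0; exact: cvgD.
by apply/funext => N; rewrite addrC subrK.
Unshelve. all: by end_near. Qed.

Lemma nsum_bounded n c : 0 < c -> exists M, forall C (F : 'rV[R]_n -> R),
  (forall u, `|F u| <= C * ngauss c u) -> `|nsum F| <= C * M.
Proof.
move=> c0; have [M M0 HM] := bsum_gauss_bounded n c0.
exists M => C F FC; have C0 : 0 <= C.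
  by have := le_trans (normr_ge0 _) (FC 0); rewrite pmulr_lge0// expR_gt0.
have cn : (fun N => `|bsum N F|) @ \oo --> `|nsum F|.
  by apply: cvg_norm; exact: nsum_cvg c0 FC.
apply: (cvgr_to_le cn); near=> N.
by rewrite (le_trans (ler_norm_bsum _ _))// (le_trans (ler_bsum _ FC))// bsumZ ler_wpM2l.
Unshelve. all: by end_near. Qed.

Lemma nsum_dominated_series n c C (F_ : nat -> 'rV[R]_n -> R) F : 0 < c ->
  (forall N u, `|F_ N u| <= C * ngauss c u) -> (forall u, F_ ^~ u @ \oo --> F u) ->
  (fun N => nsum (F_ N)) @ \oo --> nsum F.
Proof.
move=> c0; elim: n C F_ F => [|n IH] C F_ F FC FF /=; first exact: FF.
have FC' k N (u : 'rV[R]_n) :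
    `|F_ N (row_mx k%:~R%:M u)| <= C * gauss c k * ngauss c u.
  by rewrite (le_trans (FC _ _))// ngauss_row_mx mulrA.
have [M HM] := nsum_bounded n c0.
apply: (zsum_dominated (C := C * M) c0) => [N k|k]; last first.
  by apply: (IH (C * gauss c k)) => [N u|u]; [exact: FC'|exact: FF].
by rewrite mulrAC; apply: HM => u; exact: FC'.
Qed.

End DominatedSeries.

(** * Bernstein polynomials as binomial expectations *)

Section Bernstein.
Variable R : realType.
Implicit Types (f g : nat -> R) (t : R).

(* [bern N f t] is the expectation of [f] under the binomial law of parameters *)
(* [N] and [t]; the recursion conditions on the first trial.                   *)
Fixpoint bern N f t : R :=
  if N is N'.+1 then (1 - t) * bern N' f t + t * bern N' (fun j => f j.+1) t
  else f 0%N.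

Lemma bern_affine N a b f t : bern N (fun j => a * f j + b) t = a * bern N f t + b.
Proof. by elim: N f => [//|N IH] f /=; rewrite !IH; ring. Qed.

Lemma bern_le N f g t : 0 <= t <= 1 -> (forall j, f j <= g j) ->
  bern N f t <= bern N g t.
Proof.
move=> /andP[t0 t1]; elim: N f g => [|N IH] f g fg /=; first exact: fg.
by rewrite lerD// ler_wpM2l ?subr_ge0// IH.
Qed.

Lemma bern_norm_le N f t M : 0 <= t <= 1 -> (forall j, `|f j| <= M) ->
  `|bern N f t| <= M.
Proof.
move=> /andP[t0 t1]; elim: N f => [|N IH] f fM /=; first exact: fM.
rewrite (le_trans (ler_normD _ _))// !normrM (ger0_norm t0) ger0_norm ?subr_ge0//.
have := IH f fM; have := IH (fun j => f j.+1) (fun j => fM j.+1).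
move: (bern N f t) (bern N _ t) => x y; nra.
Qed.

(** Variance plus squared bias. The centre [a] is arbitrary because a first success replaces it by
    [a - 1]. *)
Lemma bern_sqr N (a : R) t :
  bern N (fun j => (j%:R - a) ^+ 2) t = N%:R * t * (1 - t) + (N%:R * t - a) ^+ 2.
Proof.
elim: N a => [|N IH] a /=; first by ring.
rewrite IH.
have -> : (fun j => (j.+1%:R - a) ^+ 2) = (fun j => (j%:R - (a - 1)) ^+ 2).
  by apply/funext => j; rewrite -natr1; congr (_ ^+ 2); ring.
by rewrite IH -[N.+1%:R]natr1; ring.
Qed.

(** The weak law of large numbers by Chebyshev's bound. Continuity is asked at the point [t] alone,
    because the functions to come involve [ln]. *)
Lemma bern_cvg (psi : R -> R) t : 0 <= t <= 1 -> (forall s, `|psi s| <= 1) ->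
  {for t, continuous psi} ->
  (fun N => bern N (fun j => psi (j%:R / N%:R)) t) @ \oo --> psi t.
Proof.
move=> t01 psi1 ct; apply/cvgrPdist_le => e e0.
have /cvgrPdist_le/(_ _ (divr_gt0 e0 (ltr0n R 2))) := ct.
move=> /nbhs_ballP[d /= d0 Hd].
(* Within [d] of [t] the difference is at most [e / 2]; farther away it is at most 2, while
   [(s - t) ^ 2 / d ^ 2 >= 1]. *)
have psi_le s : `|psi s - psi t| <= 2 / d ^+ 2 * (s - t) ^+ 2 + e / 2.
  have e2 : 0 <= e / 2 by rewrite divr_ge0// ltW.
  have d2 : 0 < d ^+ 2 by rewrite exprn_gt0.
  have [st|st] := ltP `|t - s| d.
    have := Hd s st; rewrite /= distrC => /le_trans; apply.
    by rewrite lerDr mulr_ge0 ?sqr_ge0// divr_ge0// ltW.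
  have h : 2 <= 2 / d ^+ 2 * (s - t) ^+ 2.
    rewrite mulrAC ler_pdivlMr// ler_pM2l// -[leRHS]real_normK ?num_real// distrC.
    by rewrite lerXn2r ?nnegrE// ltW.
  rewrite (le_trans (ler_normB _ _))//.
  have := psi1 s; have := psi1 t; lra.
near=> N.
have N0 : 0 < N%:R :> R by rewrite ltr0n; near: N; exact: nbhs_infty_gt.
(* The mean of [(j / N - t) ^ 2] is at most [1 / N], so this size of [N] brings the quadratic term
   below [e / 2]. *)
have dN : 4 / (d ^+ 2 * e) <= N%:R by near: N; exact: nbhs_infty_ger.
pose f j := psi (j%:R / N%:R) - psi t.
have fE : bern N (fun j => psi (j%:R / N%:R)) t - psi t = bern N f t.
  have := bern_affine N 1 (- psi t) (fun j => psi (j%:R / N%:R)) t; rewrite mul1r => <-.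
  by congr bern; apply/funext => j; rewrite mul1r.
pose g j := 2 / d ^+ 2 / N%:R ^+ 2 * (j%:R - N%:R * t) ^+ 2 + e / 2.
have fg j : `|f j| <= g j.
  apply: le_trans (psi_le _) _; rewrite /g lerD2r le_eqVlt; apply/orP; left; apply/eqP.
  by field; rewrite !gt_eqF.
have bg : bern N g t <= e.
  rewrite bern_affine bern_sqr subrr expr0n/= addr0.
  have t14 : t * (1 - t) <= 1 by case/andP: t01 => t0 t1; nra.
  rewrite (_ : 2 / d ^+ 2 / N%:R ^+ 2 * (N%:R * t * (1 - t)) = 2 / (d ^+ 2 * N%:R) * (t * (1 - t))); last by field; rewrite !gt_eqF.
  have c0 : 0 <= 2 / (d ^+ 2 * N%:R) by rewrite divr_ge0// mulr_ge0 ?sqr_ge0// ltW.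
  have : 2 / (d ^+ 2 * N%:R) <= e / 2.
    rewrite ler_pdivrMr ?mulr_gt0 ?exprn_gt0//.
    move: dN; rewrite ler_pdivrMr ?mulr_gt0 ?exprn_gt0//; lra.
  have := ler_wpM2l c0 t14; lra.
rewrite distrC fE ler_norml; apply/andP; split.
  rewrite lerNl (le_trans _ bg)//.
  rewrite (_ : - bern N f t = bern N (fun j => -1 * f j + 0) t).
    by apply: bern_le => // j; rewrite addr0 mulN1r (le_trans _ (fg j))// -normrN ler_norm.
  by rewrite bern_affine addr0 mulN1r.
rewrite (le_trans _ bg)//; apply: bern_le => // j.
by rewrite (le_trans _ (fg j))// ler_norm.
Unshelve. all: by end_near. Qed.

End Bernstein.

(** * Theta series and their inversion formula *)

Section ThetaSeries.
Variable R : realType.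
Let pi0 : 0 < pi :> R := @pi_gt0 R.
Implicit Types (n : nat) (x y tau : R).

Definition gterm n (G : 'M[R]_n) y (u : 'rV[R]_n) : R :=
  expR (- pi * y * sqnorm (u *m G)).

Lemma gterm_dom n (G : 'M[R]_n) y : G \in unitmx -> 0 < y ->
  exists2 c, 0 < c & forall u, gterm G y u <= ngauss c u.
Proof.
move=> Gu y0; have [c c0 Hc] := sqnorm_mulmx_ge Gu.
exists (pi * y * c) => [|u]; first by rewrite !mulr_gt0.
by rewrite ler_expR !mulNr lerN2 -[leLHS]mulrA ler_pM2l ?mulr_gt0.
Qed.

Lemma box_lim_gterm n (G : 'M[R]_n) y (phi : R -> R) : G \in unitmx -> 0 < y ->
  (forall r, `|phi r| <= 1) ->
  limn (fun N => \sum_(f : {ffun 'I_n -> 'I_(N.*2.+1)})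
     let r := sqnorm (box_vec R f *m G) in expR (- pi * y * r) * phi r) =
  nsum (fun u => gterm G y u * phi (sqnorm (u *m G))).
Proof.
move=> Gu y0 phi1; have [c c0 Hc] := gterm_dom Gu y0.
rewrite (_ : (fun N => _) = fun N => bsum N (fun u => gterm G y u * phi (sqnorm (u *m G)))).
  apply: cvg_lim => //; apply: (nsum_cvg c0 (C := 1)) => u.
  rewrite mul1r normrM ger0_norm ?expR_ge0// (le_trans _ (Hc u))//.
  by apply: ler_piMr; [exact: expR_ge0|exact: phi1].
by apply/funext => N; rewrite -bsum_box.
Qed.

Lemma theta_reE n (G : 'M[R]_n) x y : G \in unitmx -> 0 < y ->
  theta_re G x y = nsum (fun u => gterm G y u * cos (pi * x * sqnorm (u *m G))).
Proof.
move=> Gu y0; apply: (box_lim_gterm (phi := fun r => cos (pi * x * r))) => // r.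
exact: cos_max.
Qed.

Lemma theta_imE n (G : 'M[R]_n) x y : G \in unitmx -> 0 < y ->
  theta_im G x y = nsum (fun u => gterm G y u * sin (pi * x * sqnorm (u *m G))).
Proof.
move=> Gu y0; apply: (box_lim_gterm (phi := fun r => sin (pi * x * r))) => // r.
exact: sin_max.
Qed.

Lemma theta_imag_axisE n (G : 'M[R]_n) tau : G \in unitmx -> 0 < tau ->
  theta_imag_axis G tau = nsum (gterm G tau).
Proof.
move=> Gu tau0; rewrite /theta_imag_axis theta_reE//.
by apply: eq_nsum => u; rewrite mulr0 mul0r cos0 mulr1.
Qed.

Lemma theta_imag_axis_gt0 n (G : 'M[R]_n) tau : G \in unitmx -> 0 < tau ->
  0 < theta_imag_axis G tau.
Proof.
move=> Gu tau0; rewrite theta_imag_axisE//; have [c c0 Hc] := gterm_dom Gu tau0.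
have cn : (fun N => bsum N (gterm G tau)) @ \oo --> nsum (gterm G tau).
  by apply: (nsum_cvg c0 (C := 1)) => u; rewrite mul1r ger0_norm ?expR_ge0.
rewrite (lt_le_trans ltr01)//; apply: (cvgr_to_ge cn); near=> N.
apply: le_trans (bsum_ge_term N (fun u => expR_ge0 _)).
rewrite /gterm mul0mx (_ : sqnorm 0 = 0) ?mulr0 ?expR0//.
by apply/eqP; rewrite sqnorm_eq0.
Unshelve. all: by end_near. Qed.

Lemma sqnormZ n (a : R) (u : 'rV[R]_n) : sqnorm (a *: u) = a ^+ 2 * sqnorm u.
Proof. by rewrite /sqnorm mulr_sumr; apply: eq_bigr => i _; rewrite mxE exprMn. Qed.

(** [lattice_poisson] without phase for the lattice scaled by the square root of [tau], whose dual
    is scaled by the inverse. *)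
Lemma theta_jacobi n (G : 'M[R]_n) tau : G \in unitmx -> 0 < tau ->
  theta_imag_axis G tau =
  (Num.sqrt tau ^+ n * `|\det G|)^-1 * theta_imag_axis (dual_gen G) tau^-1.
Proof.
move=> Gu tau0; set a := Num.sqrt tau.
have a0 : 0 < a by rewrite sqrtr_gt0.
have an0 : a != 0 by rewrite gt_eqF.
have a2 : a ^+ 2 = tau by rewrite sqr_sqrtr// ltW.
have Gd : dual_gen G \in unitmx by rewrite /dual_gen unitmx_tr unitmx_inv.
have aGu : a *: G \in unitmx by rewrite unitmxZ// unitfE.
have aGd : dual_gen (a *: G) = a^-1 *: dual_gen G.
  rewrite /dual_gen (@invmx_right _ _ _ (a^-1 *: invmx G)); first by rewrite linearZ.
  by rewrite -scalemxAl -scalemxAr scalerA mulfV// scale1r mulmxV.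
rewrite !theta_imag_axisE ?invr_gt0//.
have -> : nsum (gterm G tau) = nsum (phase_theta (a *: G) 0).
  apply: eq_nsum => u; rewrite /phase_theta /dot trmx0 mulmx0 mxE mulr0 cos0 mulr1.
  by rewrite -scalemxAr sqnormZ a2 /gterm !mulNr mulrA.
rewrite lattice_poisson// detZ normrM ger0_norm ?exprn_ge0 ?ltW//; congr (_ * _).
apply: eq_nsum => u; rewrite /shift_theta subr0 aGd -scalemxAr sqnormZ exprVn a2.
by rewrite /gterm !mulNr mulrA.
Qed.

Lemma dual_gen1 n : dual_gen 1%:M = 1%:M :> 'M[R]_n.
Proof. by rewrite /dual_gen invmx1 trmx1. Qed.

(* The reference lattice is self-dual, so the factors [tau ^ (n / 2)] cancel. *)
Lemma secrecy_inv n (G : 'M[R]_n) tau : G \in unitmx -> vol G = 1 -> 0 < tau ->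
  secrecy G tau = theta_imag_axis (1%:M : 'M[R]_n) tau / theta_imag_axis G tau /\
  secrecy G tau^-1 = theta_imag_axis (1%:M : 'M[R]_n) tau / theta_imag_axis (dual_gen G) tau.
Proof.
move=> Gu G1 tau0; rewrite /secrecy G1 powR1; split=> //.
have ti0 : 0 < tau^-1 by rewrite invr_gt0.
have detG : `|\det G| = 1 by [].
rewrite (theta_jacobi (unitmx1 _ _) ti0) (theta_jacobi Gu ti0) invrK dual_gen1 det1.
rewrite normr1 detG mulr1 invfM invrK mulrACA.
by rewrite mulVf ?mul1r// expf_neq0// gt_eqF// sqrtr_gt0.
Qed.

End ThetaSeries.

(** * Moments determine the theta series on the half-plane *)

Section AnalyticContinuation.
Variable R : realType.
Let pi0 : 0 < pi :> R := @pi_gt0 R.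
Variables (n : nat) (G H : 'M[R]_n).
Hypotheses (Gu : G \in unitmx) (Hu : H \in unitmx).
Hypothesis GH : forall tau, 0 < tau -> theta_imag_axis G tau = theta_imag_axis H tau.

Lemma gterm_01 (M : 'M[R]_n) (y : R) u : 0 < y -> 0 <= gterm M y u <= 1.
Proof.
move=> y0; rewrite expR_ge0 -expR0 ler_expR !mulNr oppr_le0.
by rewrite !mulr_ge0 ?sqnorm_ge0// ltW.
Qed.

(** One factor [gterm] is kept for the decay; the remaining ones are at most 1. *)
Lemma gterm_bern_dom (M : 'M[R]_n) c (y : R) k N f u : 0 < y ->
  (forall u, gterm M y u <= ngauss c u) -> (forall j, `|f j| <= 1) ->
  `|gterm M y u ^+ k.+1 * bern N f (gterm M y u)| <= 1 * ngauss c u.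
Proof.
move=> y0 Mc f1; have t01 := gterm_01 M u y0.
have /andP[t0 t1] := t01; rewrite mul1r normrM (le_trans _ (Mc u))//.
rewrite exprS normrM -mulrA (ger0_norm t0) ler_piMr//.
rewrite mulr_ile1 ?normr_ge0 ?bern_norm_le// normrX ger0_norm//.
by rewrite exprn_ile1.
Qed.

(** Induction on the degree with [k] free, since the recursion of [bern] raises the power of
    [gterm]. The exponent stays positive because the zeroth moment diverges in positive
    dimension. *)
Lemma nsum_bern_eq (y : R) k N f : 0 < y -> (forall j, `|f j| <= 1) ->
  nsum (fun u => gterm G y u ^+ k.+1 * bern N f (gterm G y u)) =
  nsum (fun u => gterm H y u ^+ k.+1 * bern N f (gterm H y u)).
Proof.
move=> y0; have [cG cG0 dG] := gterm_dom Gu y0; have [cH cH0 dH] := gterm_dom Hu y0.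
elim: N k f => [|N IH] k f f1 /=.
  (* The power [k + 1] of [gterm] at [y] is [gterm] at [(k + 1) y], so this moment is a value of the
     theta series on the imaginary axis. *)
  have e (M : 'M[R]_n) c : 0 < c -> (forall u, gterm M y u <= ngauss c u) -> M \in unitmx ->
      nsum (fun u => gterm M y u ^+ k.+1 * f 0%N) =
      f 0%N * theta_imag_axis M (k.+1%:R * y).
    move=> c0 dM Mu; rewrite theta_imag_axisE ?mulr_gt0//.
    have [c' c'0 Hc'] := gterm_dom Mu (mulr_gt0 (ltr0Sn R k) y0).
    rewrite -(nsumZ _ c'0 (C := 1)) => [|u]; last by rewrite mul1r ger0_norm ?expR_ge0.
    apply: eq_nsum => u; rewrite mulrC; congr (_ * _).
    by rewrite /gterm -expRM_natl; congr expR; ring.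
  by rewrite (e G cG)// (e H cH)// GH// mulr_gt0.
have split_bern (M : 'M[R]_n) c : 0 < c -> (forall u, gterm M y u <= ngauss c u) ->
    nsum (fun u => gterm M y u ^+ k.+1 *
      ((1 - gterm M y u) * bern N f (gterm M y u) +
       gterm M y u * bern N (fun j => f j.+1) (gterm M y u))) =
    nsum (fun u => gterm M y u ^+ k.+1 * bern N f (gterm M y u)) +
    (-1 * nsum (fun u => gterm M y u ^+ k.+2 * bern N f (gterm M y u)) +
     nsum (fun u => gterm M y u ^+ k.+2 * bern N (fun j => f j.+1) (gterm M y u))).
  move=> c0 dM.
  have B k' f' u : (forall j, `|f' j| <= 1) ->
      `|gterm M y u ^+ k'.+1 * bern N f' (gterm M y u)| <= 1 * ngauss c u.
    by move=> f'1; exact: gterm_bern_dom.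
  have f1' j : `|f j.+1| <= 1 by exact: f1.
  rewrite -(nsumZ _ c0 (fun u => B k.+1 f u f1)).
  have B' u : `|-1 * (gterm M y u ^+ k.+2 * bern N f (gterm M y u))| <= 1 * ngauss c u.
    by rewrite mulN1r normrN; exact: B.
  rewrite -(nsumD c0 B' (fun u => B k.+1 _ u f1')).
  have B'' u : `|-1 * (gterm M y u ^+ k.+2 * bern N f (gterm M y u)) +
      gterm M y u ^+ k.+2 * bern N (fun j => f j.+1) (gterm M y u)| <= 2 * ngauss c u.
    rewrite (le_trans (ler_normD _ _))// mulrDl; apply: lerD; first exact: B'.
    exact: B.
  rewrite -(nsumD c0 (fun u => B k f u f1) B''); apply: eq_nsum => u.
  by rewrite !exprS; ring.
by rewrite (split_bern G cG)// (split_bern H cH)// !IH.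
Qed.

(** The Bernstein approximations converge pointwise and the factor [gterm] dominates them.
    Continuity is asked on the positive reals, where [gterm] takes its values. *)
Lemma nsum_continuous_eq (y : R) (psi : R -> R) : 0 < y ->
  (forall s, `|psi s| <= 1) -> (forall s, 0 < s -> {for s, continuous psi}) ->
  nsum (fun u => gterm G y u * psi (gterm G y u)) =
  nsum (fun u => gterm H y u * psi (gterm H y u)).
Proof.
move=> y0 psi1 psic.
have cv (M : 'M[R]_n) : M \in unitmx ->
    (fun N => nsum (fun u => gterm M y u ^+ 1 *
       bern N (fun j => psi (j%:R / N%:R)) (gterm M y u))) @ \oo -->
    nsum (fun u => gterm M y u * psi (gterm M y u)).
  move=> Mu; have [c c0 dM] := gterm_dom Mu y0.
  apply: (nsum_dominated_series c0 (C := 1)) => [N u|u].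
    by apply: gterm_bern_dom.
  apply: cvgM; first exact: cvg_cst.
  apply: bern_cvg => //; first exact: gterm_01.
  by apply: psic; exact: expR_gt0.
rewrite -(cvg_lim _ (cv G Gu))// -(cvg_lim _ (cv H Hu))//.
by congr (limn _); apply/funext => N; exact: nsum_bern_eq.
Qed.

Lemma theta_eq_of_imag_axis (x y : R) : 0 < y ->
  theta_re G x y = theta_re H x y /\ theta_im G x y = theta_im H x y.
Proof.
move=> y0; rewrite !theta_reE// !theta_imE//.
(* The logarithm recovers the squared norm, so the oscillating factor is a function of [gterm]. *)
have lnE (M : 'M[R]_n) (u : 'rV[R]_n) :
    - (x / y) * ln (gterm M y u) = pi * x * sqnorm (u *m M).
  by rewrite /gterm expRK; move: (pi : R) => P; field; rewrite gt_eqF.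
have cln (s : R) : 0 < s -> {for s, continuous (fun s => - (x / y) * ln s)}.
  by move=> s0; apply: cvgM; [exact: cvg_cst|exact: continuous_ln].
split.
- have := @nsum_continuous_eq y (fun s => cos (- (x / y) * ln s)) y0.
  have e (M : 'M[R]_n) u : gterm M y u * cos (- (x / y) * ln (gterm M y u)) =
      gterm M y u * cos (pi * x * sqnorm (u *m M)) by rewrite lnE.
  rewrite (eq_nsum (e G)) (eq_nsum (e H)); apply => [s|s s0]; first exact: cos_max.
  by apply: continuous_comp; [exact: cln|exact: continuous_cos].
- have := @nsum_continuous_eq y (fun s => sin (- (x / y) * ln s)) y0.
  have e (M : 'M[R]_n) u : gterm M y u * sin (- (x / y) * ln (gterm M y u)) =
      gterm M y u * sin (pi * x * sqnorm (u *m M)) by rewrite lnE.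
  rewrite (eq_nsum (e G)) (eq_nsum (e H)); apply => [s|s s0]; first exact: sin_max.
  by apply: continuous_comp; [exact: cln|exact: continuous_sin].
Qed.

End AnalyticContinuation.

Theorem theorem1 (R : realType) (n : nat) (G : 'M[R]_n)
    (Hfull : G \in unitmx) (Hvol : vol G = 1) :
  (forall tau : R, 0 < tau -> secrecy G tau = secrecy G tau^-1)
  <-> formally_unimodular G.
Proof.
have Gd : dual_gen G \in unitmx by rewrite /dual_gen unitmx_tr unitmx_inv.
split=> [sym x y y0|fu tau tau0].
  apply: theta_eq_of_imag_axis => // tau tau0.
  have [e1 e2] := secrecy_inv Hfull Hvol tau0.
  (* Both secrecy values have the theta series of Z^n at [tau] as numerator; it is positive and
     cancels. *)
  have := sym tau tau0; rewrite e1 e2 => /mulfI e.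
  apply: invr_inj; apply: e.
  by rewrite gt_eqF// theta_imag_axis_gt0// unitmx1.
have [-> ->] := secrecy_inv Hfull Hvol tau0.
by rewrite /theta_imag_axis (proj1 (fu 0 tau tau0)).
Qed.
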